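(* All of the following tuples are universal: $(9,1,4,2,3,1)$, $(9,3,9,1,3,1)$, $(9,5,4,2,4,2)$, $(9,5,5,3,5,1)$, $(9,5,8,4,2,0)$, $(9,5,9,3,3,1)$, $(9,7,4,2,4,2)$, $(9,7,5,3,5,1)$, $(9,7,8,4,2,0)$, $(9,c,3,1,3,1)$ for $c\in\{1,5,7\}$, and $(10,6,10,2,6,4)$.
   Context: For $a_1,b_1,c_1$ positive integers and $a_2,b_2,c_2$ integers with $a_1-a_2$, $b_1-b_2$, $c_1-c_2$ all even, the tuple $(a_1,a_2,b_1,b_2,c_1,c_2)$ is called universal if every nonnegative integer $n$ can be written as $\frac{x(a_1x+a_2)}2+\frac{y(b_1y+b_2)}2+\frac{z(c_1z+c_2)}2$ with $x,y,z\in\mathbb{Z}$. *)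

(* Defs.v *)
From mathcomp Require Import all_boot all_order all_algebra.

Set Implicit Arguments.
Unset Strict Implicit.
Unset Printing Implicit Defensive.

Import Order.TTheory GRing.Theory Num.Theory.
Local Open Scope ring_scope.

(* The division by 2 takes place in rat, so that no rounding is involved. *)
Definition half_value (a1 a2 x : int) : rat := (x * (a1 * x + a2))%:Q / 2.

Definition admissible (a1 a2 b1 b2 c1 c2 : int) : Prop :=
  [/\ 0 < a1, 0 < b1 & 0 < c1] /\
  [/\ (2 %| a1 - a2)%Z, (2 %| b1 - b2)%Z & (2 %| c1 - c2)%Z].

(* Universality is only defined for tuples subject to the sign and parity
   conditions, so these are part of the predicate. *)
Definition universal (a1 a2 b1 b2 c1 c2 : int) : Prop :=
  admissible a1 a2 b1 b2 c1 c2 /\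
  forall n : nat, exists x y z : int,
    n%:R = half_value a1 a2 x + half_value b1 b2 y + half_value c1 c2 z.

(* Main.v *)
Require Import Defs.
From mathcomp Require Import all_boot all_order all_algebra.
From mathcomp Require Import finfield zify ring lra.
Set Implicit Arguments.
Unset Strict Implicit.
Unset Printing Implicit Defensive.
Import Order.TTheory GRing.Theory Num.Theory.
Local Open Scope ring_scope.

(** Completing squares turns each claim into a representation of numbers in a
    progression by a diagonal ternary form with congruence conditions on the
    variables. Multiplications by [(1 + sqrt(-3)) / 2] and by [1 + 2i], [3 + 4i]
    move representations around, so that everything follows from four facts:
    8m+3 is a sum of three squares, 24m+7 and 12m+10 have the form
    x^2+3y^2+3z^2, and 24m+13 has the form x^2+y^2+3z^2.

    For these, take a quadratic character chi attached to -K. If chi(a) = 1, some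
    m = a (mod M) has sum_{d | m} chi(d) > 0, whence m = k^2 A with A squarefree
    and -K a square modulo A. This replaces the usual appeal to Dirichlet's theorem
    on primes in progressions and is elementary: a Cesaro mean of the divisor sums
    (nonnegative, and at least 1 at squares) shows that X L_X is unbounded, where
    L_X = sum_{d <= X} chi(d)/d, and then Dirichlet's hyperbola method on the
    progression gives a positive total. From A, k and a square root of -K modulo A
    one writes down a positive ternary form of determinant 1 or 3 representing the
    number in question, and reduction theory identifies that form. *)

(** * The Jacobi symbol *)

(* Gauss-Schering: for odd [n] the product below is the Jacobi symbol (a/n), for
   composite [n] too; a factor vanishes exactly when [a] and [n] share a divisor. *)
Definition half_sign (n a : nat) : int :=
  if (n %| a)%N then 0 else if (a %% n <= n./2)%N then 1 else -1.

Definition jacobi (a n : nat) : int :=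
  \prod_(1 <= x < n./2.+1) half_sign n (a * x).

(** The absolutely least residue: for odd [n], [a] is congruent to [half_sign n a * half_abs n a]
    modulo [n]. *)
Definition half_abs (n a : nat) : nat :=
  if (a %% n <= n./2)%N then (a %% n)%N else (n - a %% n)%N.

Lemma half_sign_mod n a b : a = b %[mod n] -> half_sign n a = half_sign n b.
Proof. by move=> E; rewrite /half_sign /dvdn E. Qed.

Lemma jacobi_mod n a b : a = b %[mod n] -> jacobi a n = jacobi b n.
Proof.
move=> E; apply: eq_big_nat => x _; apply: half_sign_mod.
by rewrite -modnMml E modnMml.
Qed.

Lemma half_sign_eq0 n a : (half_sign n a == 0) = (n %| a)%N.
Proof. by rewrite /half_sign; case: ifP => // _; case: ifP. Qed.

Lemma odd_halfK n : odd n -> n = (n./2 + n./2).+1%N.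
Proof. lia. Qed.

Lemma half_signN n a b : odd n -> (n %| a + b)%N ->
  half_sign n a = - half_sign n b.
Proof.
move=> nodd dvd; rewrite /half_sign.
have n0 : (0 < n)%N by case: n nodd {dvd}.
have ra := ltn_pmod a n0; have rb := ltn_pmod b n0.
have Hdvd : (n %| a %% n + b %% n)%N by rewrite /dvdn modnDml modnDmr.
have H2 := odd_halfK nodd.
have [q Hq] := dvdnP Hdvd.
have Hq2 : (q < 2)%N by nia.
rewrite /dvdn.
case: q Hq Hq2 => [|[|q]] Hq Hq2 //.
  have -> : (a %% n = 0)%N by lia. have -> : (b %% n = 0)%N by lia.
  by rewrite eqxx.
rewrite mul1n in Hq.
have -> : (a %% n == 0)%N = false by lia.
have -> : (b %% n == 0)%N = false by lia.
case: ifP => h1; case: ifP => h2 //; lia.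
Qed.

Lemma half_abs_congr n a : odd n ->
  half_abs n a = a %[mod n] \/ (n %| half_abs n a + a)%N.
Proof.
move=> nodd; have n0 : (0 < n)%N by case: n nodd.
have := ltn_pmod a n0 => h1.
rewrite /half_abs; case: ifP => h; [left|right]; first by rewrite modn_mod.
by rewrite {2}(divn_eq a n) addnCA subnK ?dvdn_addr ?dvdn_mull// ltnW.
Qed.

(** Modulo [n], replacing [a] by [half_abs n a] changes [c * a] at most by the sign of [a]. This
    cocycle rule is what makes [jacobi] multiplicative. *)
Lemma half_sign_half_abs n a c : odd n ->
  half_sign n (c * a) = half_sign n a * half_sign n (c * half_abs n a).
Proof.
move=> nodd; have n0 : (0 < n)%N by case: n nodd.
rewrite {2}/half_sign /half_abs.
case: ifP => [nda|_].
  by rewrite mul0r; apply/eqP; rewrite half_sign_eq0 dvdn_mull.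
case: ifP => h; first by rewrite mul1r; apply: half_sign_mod; rewrite modnMmr.
rewrite mulN1r; apply: half_signN => //.
have := ltn_pmod a n0 => h1.
by rewrite -mulnDr dvdn_mull// {1}(divn_eq a n) -addnA subnKC ?dvdn_addr ?dvdn_mull// ltnW.
Qed.

(** Gauss's lemma: if [a * x] and [a * y] agree up to sign modulo [n], then [n] divides [x - y] or
    [x + y], and on [1..n./2] this forces [x = y]. An injective map of the range into itself
    permutes it. *)
Lemma half_abs_perm n a : odd n -> coprime a n ->
  perm_eq [seq half_abs n (a * x) | x <- index_iota 1 n./2.+1] (index_iota 1 n./2.+1).
Proof.
move=> nodd cop.
have n0 : (0 < n)%N by case: n nodd {cop}.
have n2 := odd_halfK nodd.
have dvdM x : (n %| a * x)%N = (n %| x)%N by rewrite Gauss_dvdr// coprime_sym.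
have small x : (0 < x < n)%N -> (n %| x)%N = false.
  by move=> /andP[x0 xn]; apply/negP=> /(dvdn_leq x0); lia.
have U : uniq [seq half_abs n (a * x) | x <- index_iota 1 n./2.+1].
  rewrite map_inj_in_uniq ?iota_uniq// => x y; rewrite !mem_index_iota => xh yh E.
  have key : (n %| x + y)%N \/ (x = y %[mod n]).
    have cast u v : (a * u = a * v %[mod n]) -> u = v %[mod n].
      move=> /eqP; wlog: u v / (u <= v)%N => [H|uv].
        by case/orP: (leq_total u v) => uv E'; [exact: H|symmetry; apply: H => //; rewrite eq_sym].
      by rewrite eq_sym eqn_mod_dvd ?leq_mul// -mulnBr dvdM -eqn_mod_dvd// eq_sym => /eqP.
    case: (half_abs_congr (a*x) nodd); rewrite E => Hx;
    case: (half_abs_congr (a*y) nodd) => Hy.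
    - by right; apply: cast; rewrite -Hx.
    - left; rewrite -dvdM mulnDr; move: Hy; rewrite /dvdn -modnDml Hx modnDml //.
    - left; rewrite -dvdM mulnDr; move: Hx; rewrite addnC /dvdn -modnDmr Hy modnDmr //.
    - right; apply: cast; apply/eqP.
      rewrite -(eqn_modDl (half_abs n (a * y))); move: Hx Hy; rewrite /dvdn.
      by move=> /eqP-> /eqP->.
  case: key => [D|]; last by rewrite !modn_small; lia.
  by move: D; rewrite small//; lia.
apply: uniq_perm => //; first exact: iota_uniq.
have S : {subset [seq half_abs n (a * x) | x <- index_iota 1 n./2.+1] <= index_iota 1 n./2.+1}.
  move=> y /mapP[x]; rewrite !mem_index_iota => xh ->.
  have : ~~ (n %| a * x)%N by rewrite dvdM small //; lia.
  have := ltn_pmod (a * x) n0.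
  by rewrite /half_abs /dvdn; case: ifP; lia.
by case: (uniq_min_size U S _) => //; rewrite size_map.
Qed.

Lemma jacobi_prod n a (F : nat -> int) : odd n -> coprime a n ->
  \prod_(1 <= x < n./2.+1) F (half_abs n (a * x)) = \prod_(1 <= x < n./2.+1) F x.
Proof.
move=> nodd cop.
by rewrite -(big_map (fun x => half_abs n (a * x)) xpredT) (perm_big _ (half_abs_perm nodd cop)).
Qed.

Lemma jacobi_eq0 n a : odd n -> (jacobi a n == 0) = ~~ coprime a n.
Proof.
move=> nodd; have n0 : (0 < n)%N by case: n nodd.
have n2 := odd_halfK nodd.
apply/idP/idP.
  rewrite /jacobi prodf_seq_eq0 => /hasP[x]; rewrite mem_index_iota => /andP[x0 xh].
  rewrite /= half_sign_eq0; apply: contraL => cop.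
  by rewrite Gauss_dvdr 1?coprime_sym//; apply/negP=> /(dvdn_leq x0); lia.
move=> ncop; set g := gcdn a n.
have g0 : (0 < g)%N by rewrite gcdn_gt0 n0 orbT.
have gn : (g %| n)%N := dvdn_gcdr _ _.
have ga : (g %| a)%N := dvdn_gcdl _ _.
have god : odd g := dvdn_odd gn nodd.
have g1 : g != 1%N by [].
have g3 : (3 <= g)%N by lia.
have [q Hq] := dvdnP gn; have [b Hb] := dvdnP ga.
have q0 : (0 < q)%N by rewrite lt0n; apply/eqP=> q0; move: n0; rewrite Hq q0.
(* [q = n / g] is at most [n./2] since [g >= 3], and [n] divides [a * q]. *)
rewrite /jacobi prodf_seq_eq0; apply/hasP; exists q.
  by rewrite mem_index_iota q0 /=; nia.
by rewrite /= half_sign_eq0 Hb {1}Hq -mulnA [(g * q)%N]mulnC dvdn_mull.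
Qed.

(** Reindexing the product for [a] along [x -> half_abs n (b * x)] lets [half_sign_half_abs] merge
    the factors; if [b] is not coprime to [n], both sides vanish. *)
Lemma jacobiM n a b : odd n -> jacobi (a * b) n = jacobi a n * jacobi b n.
Proof.
move=> nodd; have [cb|ncb] := boolP (coprime b n); last first.
  have -> : jacobi b n = 0 by apply/eqP; rewrite jacobi_eq0.
  by rewrite mulr0; apply/eqP; rewrite jacobi_eq0// coprimeMl negb_and ncb orbT.
rewrite /jacobi -[X in X * _](jacobi_prod (fun y => half_sign n (a * y)) nodd cb) -big_split /=.
by apply: eq_bigr => x _; rewrite -mulnA half_sign_half_abs// mulrC.
Qed.

Lemma half_sign_sqr n a : ~~ (n %| a)%N -> half_sign n a * half_sign n a = 1.
Proof. by rewrite /half_sign => /negPf->; case: ifP. Qed.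

Lemma jacobi_sqr n a : odd n -> coprime a n -> jacobi a n * jacobi a n = 1.
Proof.
move=> nodd cop; rewrite -big_split /= big1_seq// => x /=; rewrite mem_index_iota => /andP[x0 xh].
rewrite half_sign_sqr// Gauss_dvdr 1?coprime_sym//; apply/negP=> /(dvdn_leq x0).
by have := odd_halfK nodd; lia.
Qed.

Lemma jacobi_pm1 n a : odd n -> coprime a n -> jacobi a n = 1 \/ jacobi a n = -1.
Proof. by move=> nodd cop; apply/pred2P; rewrite -sqrf_eq1 expr2 jacobi_sqr. Qed.

Lemma jacobi1 n : odd n -> jacobi 1 n = 1.
Proof.
move=> nodd; have := jacobi_sqr nodd (coprime1n n).
by rewrite -jacobiM.
Qed.

Lemma jacobiN1 n a : odd n -> (n %| a.+1)%N -> jacobi a n = (-1) ^+ n./2.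
Proof.
move=> nodd dvd; have n2 := odd_halfK nodd.
rewrite /jacobi [LHS](@eq_big_nat _ _ _ _ _ _ (fun _ => -1)).
  by rewrite prodr_const_nat subn1.
move=> x /andP[x0 xh].
rewrite (@half_signN _ _ x nodd); last by rewrite -{2}(mul1n x) -mulnDl addn1 dvdn_mulr.
rewrite /half_sign modn_small; last by lia.
have -> : (n %| x)%N = false by apply/negP=> /(dvdn_leq x0); lia.
by have -> : (x <= n./2)%N by rewrite -ltnS.
Qed.

(** [2 * x] stays below [n] on the range, so the sign changes only once, after [x = n./2./2]. *)
Lemma jacobi2 n : odd n -> jacobi 2 n = (-1) ^+ (n./2 - n./2./2).
Proof.
move=> nodd; have n2 := odd_halfK nodd.
rewrite /jacobi (@big_cat_nat _ _ _ (n./2./2).+1) ?ltnS //=; last by lia.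
rewrite big1_seq ?mul1r; last first.
  move=> x; rewrite mem_index_iota => /andP[_ /andP[x0 xh]].
  rewrite /half_sign modn_small; last by lia.
  have -> : (n %| 2 * x)%N = false by apply/negP=> /(dvdn_leq _); lia.
  by case: ifP => //; lia.
rewrite [LHS](@eq_big_nat _ _ _ _ _ _ (fun _ => -1)); first by rewrite prodr_const_nat subSS.
move=> x /andP[x0 xh].
rewrite /half_sign modn_small; last by lia.
have -> : (n %| 2 * x)%N = false by apply/negP=> /(dvdn_leq _); lia.
by case: ifP => //; lia.
Qed.

(** Read [a = (a %/ n) * n + a %% n] modulo 2: as [n] is odd, the remainder has the parity of
    [half_abs n a] exactly when the sign is [+1]. *)
Lemma half_sign_parity n a : odd n -> ~~ (n %| a)%N ->
  half_sign n a = (-1) ^+ (a + a %/ n + half_abs n a).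
Proof.
move=> nodd nda; have n0 : (0 < n)%N by case: n nodd {nda}.
rewrite -signr_odd !oddD [odd a](congr1 odd (divn_eq a n)) oddD oddM nodd andbT.
rewrite /half_sign /half_abs (negPf nda).
case: ifP => h; first by case: (odd _); case: (odd _).
by rewrite oddB ?nodd 1?ltnW ?ltn_pmod//; case: (odd _); case: (odd _).
Qed.

(** In the product of [half_sign_parity], the values [half_abs n (m * x)] run through the range
    again and cancel against the [m * x] because [m] is odd; only the floors survive. *)
Lemma jacobi_floor n m : odd n -> odd m -> coprime m n ->
  jacobi m n = \prod_(1 <= x < n./2.+1) (-1) ^+ (m * x %/ n).
Proof.
move=> nodd modd cop; have n2 := odd_halfK nodd.
rewrite /jacobi [LHS](@eq_big_nat _ _ _ _ _ _ (fun x =>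
  (-1) ^+ (m * x) * (-1) ^+ (m * x %/ n) * (-1) ^+ (half_abs n (m * x)))); last first.
  move=> x /andP[x0 xh]; rewrite half_sign_parity ?exprD//.
  by rewrite Gauss_dvdr 1?coprime_sym//; apply/negP=> /(dvdn_leq x0); lia.
rewrite 2!big_split /= (jacobi_prod (fun y => (-1) ^+ y))// mulrAC -big_split /=.
rewrite big1 ?mul1r// => x _.
by rewrite -exprD -signr_odd oddD oddM modd addbb.
Qed.

Lemma prod_sign_leq k q : (q <= k)%N ->
  \prod_(1 <= y < k.+1) (if (y <= q)%N then -1 else 1) = (-1) ^+ q :> int.
Proof.
move=> qk; rewrite (@big_cat_nat _ _ _ q.+1) ?ltnS //=.
rewrite [X in _ * X]big1_seq ?mulr1; last first.
  by move=> y; rewrite mem_index_iota => /andP[_ /andP[y0 _]]; rewrite leqNgt y0.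
rewrite [LHS](@eq_big_nat _ _ _ _ _ _ (fun _ => -1)); first by rewrite prodr_const_nat subn1.
by move=> y /andP[_]; rewrite ltnS => ->.
Qed.

(** Eisenstein's lattice count: each floor product counts the points of a rectangle on one side of
    its diagonal, and coprimality keeps all points off the diagonal. *)
Lemma jacobi_reciprocity n m : odd n -> odd m -> coprime m n ->
  jacobi m n * jacobi n m = (-1) ^+ (n./2 * m./2).
Proof.
move=> nodd modd cop; have n2 := odd_halfK nodd; have m2 := odd_halfK modd.
have n0 : (0 < n)%N by case: n nodd {n2 cop}.
have m0 : (0 < m)%N by case: m modd {m2 cop}.
rewrite !jacobi_floor// 1?coprime_sym//.
have floorE u v : odd u -> odd v -> \prod_(1 <= x < u./2.+1) (-1) ^+ (v * x %/ u) =
    \prod_(1 <= x < u./2.+1) \prod_(1 <= y < v./2.+1) (if (y * u <= v * x)%N then -1 else 1) :> int.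
  move=> uo vo; have u2 := odd_halfK uo; have v2 := odd_halfK vo.
  apply: eq_big_nat => x /andP[x0 xh]; rewrite -(@prod_sign_leq v./2).
    by apply: eq_bigr => y _; rewrite leq_divRL// u2.
  by rewrite -ltnS ltn_divLR; nia.
rewrite !floorE// [X in _ * X]exchange_big_nat -big_split /=.
rewrite [LHS](@eq_big_nat _ _ _ _ _ _ (fun _ => (-1) ^+ m./2)).
  by rewrite prodr_const_nat subn1 exprM exprAC.
move=> x /andP[x0 xh]; rewrite -big_split /=.
rewrite [LHS](@eq_big_nat _ _ _ _ _ _ (fun _ => -1)); first by rewrite prodr_const_nat subn1.
move=> y /andP[y0 yh].
have : (y * n != m * x)%N.
  apply/eqP=> E; have : (n %| m * x)%N by rewrite -E dvdn_mull.
  by rewrite Gauss_dvdr 1?coprime_sym// => /(dvdn_leq x0); lia.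
by rewrite [(x * m)%N]mulnC [(n * y)%N]mulnC; case: ltngtP.
Qed.

(** The product of all [a * x] over the half system is evaluated twice: by pulling out the powers of
    [a], and by signs together with [half_abs_perm]. *)
Lemma jacobi_euler p a : prime p -> odd p ->
  (jacobi a p)%:~R = a%:R ^+ p./2 :> 'F_p.
Proof.
move=> pr podd; have p2 := odd_halfK podd.
have [cop|ncop] := boolP (coprime a p); last first.
  have -> : jacobi a p = 0 by apply/eqP; rewrite jacobi_eq0.
  have dv : (p %| a)%N by rewrite coprime_sym prime_coprime// negbK in ncop.
  have -> : a%:R = 0 :> 'F_p by apply/eqP; rewrite -(dvdn_pcharf (pchar_Fp pr)).
  by have := prime_gt1 pr; rewrite expr0n => ?; case: (p./2) p2 => //; lia.
have NZ x : (1 <= x < p./2.+1)%N -> x%:R != 0 :> 'F_p.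
  move=> /andP[x0 xh]; rewrite -(dvdn_pcharf (pchar_Fp pr)).
  by apply/negP=> /(dvdn_leq x0); lia.
have HA x : (a * x)%:R = (half_sign p (a * x))%:~R * (half_abs p (a * x))%:R :> 'F_p.
  have [dv|ndv] := boolP (p %| a * x)%N.
    by rewrite /half_sign dv mul0r; apply/eqP; rewrite -(dvdn_pcharf (pchar_Fp pr)).
  rewrite /half_sign /half_abs (negPf ndv) {1}(divn_eq (a * x) p).
  have p0 : p%:R = 0 :> 'F_p by rewrite pchar_Fp_0.
  rewrite natrD natrM p0 mulr0 add0r.
  case: ifP => _; first by rewrite mul1r.
  by rewrite natrB 1?ltnW ?ltn_pmod ?prime_gt0// p0 sub0r mulrN1z mulN1r opprK.
pose P := \prod_(1 <= x < p./2.+1) x%:R : 'F_p.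
have P0 : P != 0.
  by rewrite prodf_seq_neq0; apply/allP=> x; rewrite mem_index_iota /= => /NZ.
apply: (mulIf P0); rewrite rmorph_prod /=.
transitivity (\prod_(1 <= x < p./2.+1) (a * x)%:R : 'F_p); last first.
  under eq_bigr do rewrite natrM.
  by rewrite big_split /= prodr_const_nat subn1.
rewrite [RHS](eq_bigr _ (fun x _ => HA x)).
rewrite big_split /=; congr (_ * _).
rewrite -(big_map (fun x => half_abs p (a * x)) xpredT (fun y => y%:R : 'F_p)).
by rewrite (perm_big _ (half_abs_perm podd cop)).
Qed.

(** The squares of [1..p./2] are [p./2] distinct roots of ['X^(p./2) - 1], hence all of them, and
    Euler's criterion makes [a] a root. *)
Lemma jacobi_square p a : prime p -> odd p -> jacobi a p = 1 ->
  exists b, b ^ 2 = a %[mod p].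
Proof.
move=> pr podd J1; have p2 := odd_halfK podd.
have E : a%:R ^+ p./2 = 1 :> 'F_p by rewrite -jacobi_euler// J1.
have p1 := prime_gt1 pr; have h0 : (0 < p./2)%N by lia.
pose Q : {poly 'F_p} := 'X^(p./2) - 1.
have sQ : size Q = p./2.+1 by rewrite size_XnsubC.
have Q0 : Q != 0 by rewrite -size_poly_eq0 sQ.
have FE u v : (u%:R == v%:R :> 'F_p) = (u == v %[mod p]).
  by rewrite -val_eqE /= !val_Fp_nat.
pose rs := [seq (x ^ 2)%:R : 'F_p | x <- index_iota 1 p./2.+1].
have rsQ : all (root Q) rs.
  apply/allP=> _ /mapP[x + ->]; rewrite mem_index_iota => /andP[x0 xh].
  rewrite rootE !hornerE natrX -exprM mulnC muln2.
  have -> : (p./2.*2 = p.-1)%N by lia.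
  have nz : x%:R != 0 :> 'F_p.
    by rewrite -(dvdn_pcharf (pchar_Fp pr)); apply/negP=> /(dvdn_leq x0); lia.
  rewrite subr_eq0; apply/eqP/(mulfI nz).
  by have := expf_card (x%:R : 'F_p); rewrite card_Fp // mulr1 -exprS prednK // ltnW.
have rsU : uniq rs.
  rewrite map_inj_in_uniq ?iota_uniq// => x y; rewrite !mem_index_iota => /andP[x0 xh] /andP[y0 yh].
  move/eqP; rewrite !natrX eqf_sqr => /orP[]; first by rewrite FE !modn_small => [/eqP||]; lia.
  rewrite -subr_eq0 opprK -natrD -(dvdn_pcharf (pchar_Fp pr)) => /dvdn_leq; lia.
have aQ : root Q a%:R by rewrite rootE !hornerE E subrr.
have : a%:R \in rs.
  apply/negPn/negP=> nin.
  have := @max_poly_roots _ Q (a%:R :: rs) Q0; rewrite /= aQ rsQ nin rsU sQ size_map size_iota.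
  by move=> /(_ isT isT); lia.
by case/mapP=> x _ /eqP; rewrite FE => /eqP e; exists x.
Qed.

(** * Divisor sums of a real character *)

(** A real Dirichlet character, possibly principal. Being nonprincipal is kept separate so that
    products of characters can be formed first. *)
Record sign_character (M : nat) (chi : nat -> int) : Prop := SignCharacter {
  rchar_gt0 : (0 < M)%N;
  rchar_mod : forall a b, a = b %[mod M] -> chi a = chi b;
  rcharM : forall a b, chi (a * b)%N = chi a * chi b;
  rchar1 : chi 1%N = 1;
  rchar_eq0 : forall a, (chi a == 0) = ~~ coprime a M;
  rchar_sqr : forall a, coprime a M -> chi a * chi a = 1 }.

Record real_character (M : nat) (chi : nat -> int) : Prop := RealCharacter {
  rchar_sign :> sign_character M chi;
  rchar_nonprincipal : exists u, chi u = -1 }.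

Lemma rchar_val M chi a : real_character M chi ->
  [\/ chi a = 0, chi a = 1 | chi a = -1].
Proof.
move=> H; have [cop|ncop] := boolP (coprime a M).
  have := rchar_sqr H cop; move/eqP; rewrite -expr2 sqrf_eq1 => /orP[]/eqP ->.
    by constructor 2. by constructor 3.
by constructor 1; apply/eqP; rewrite (rchar_eq0 H).
Qed.

Lemma rchar_norm M chi a : real_character M chi -> `|chi a| <= 1.
Proof. by move=> /(rchar_val a)[]->. Qed.

Lemma rcharX M chi a n : real_character M chi -> chi (a ^ n)%N = chi a ^+ n.
Proof.
move=> H; elim: n => [|n IH]; first by rewrite (rchar1 H).
by rewrite expnS (rcharM H) IH exprS.
Qed.

(** Multiplication by some [u] with [chi u = -1] permutes the residues, so the sum is its own
    negative. *)
Lemma rchar_sum_period M chi : real_character M chi ->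
  \sum_(0 <= d < M) chi d = 0.
Proof.
move=> H; have [u Hu] := rchar_nonprincipal H.
have cop : coprime u M.
  by apply/negPn; rewrite -(rchar_eq0 H) Hu.
have M0 := rchar_gt0 H.
suff : \sum_(0 <= d < M) chi d = - \sum_(0 <= d < M) chi d by lia.
rewrite -[in RHS]mulN1r -Hu big_distrr /=.
have P : perm_eq [seq ((u * x) %% M)%N | x <- index_iota 0 M] (index_iota 0 M).
  have U : uniq [seq ((u * x) %% M)%N | x <- index_iota 0 M].
    rewrite map_inj_in_uniq ?iota_uniq// => x y; rewrite !mem_index_iota /=.
    wlog xy : x y / (x <= y)%N => [W|].
      by case/orP: (leq_total x y) => xy ?? E; [|symmetry]; apply: W.
    move=> xM yM /eqP; rewrite eq_sym eqn_mod_dvd ?leq_mul// -mulnBr Gauss_dvdr 1?coprime_sym//.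
    by move=> D; apply/eqP; rewrite eqn_leq xy -subn_eq0 /= -leqn0 leqNgt; apply/negP=> /dvdn_leq/(_ D); lia.
  have S : {subset [seq ((u * x) %% M)%N | x <- index_iota 0 M] <= index_iota 0 M}.
    by move=> y /mapP[x _ ->]; rewrite mem_index_iota /= ltn_pmod.
  apply: uniq_perm => //; first exact: iota_uniq.
  by case: (uniq_min_size U S _) => //; rewrite size_map.
rewrite -(perm_big _ P) big_map; apply: eq_bigr => x _.
by rewrite -(rcharM H); apply: (rchar_mod H); rewrite modn_mod.
Qed.

Lemma rchar_sum_window M chi s : real_character M chi ->
  \sum_(s <= d < s + M) chi d = 0.
Proof.
move=> H; elim: s => [|s IH]; first by rewrite add0n rchar_sum_period.
have M0 := rchar_gt0 H.
move: IH; rewrite big_ltn; last by lia.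
rewrite addSn big_nat_recr /=; last by lia.
by rewrite (rchar_mod H (_ : (s + M = s %[mod M])%N)) ?modnDr// addrC.
Qed.

Lemma rchar_sum_windows M chi s t : real_character M chi ->
  \sum_(s <= d < s + t * M) chi d = 0.
Proof.
move=> H; elim: t => [|t IH]; first by rewrite addn0 big_geq.
rewrite mulSnr addnA (@big_cat_nat _ _ _ (s + t * M)) /= ?leq_addr//.
by rewrite IH add0r rchar_sum_window.
Qed.

Definition divisor_sum (chi : nat -> int) (m : nat) : int :=
  \sum_(d <- divisors m) chi d.

(** Induction on [v]: the divisors of [p ^ v.+1 * m] that do not divide [p ^ v * m] are the
    [p ^ v.+1 * e] with [e] dividing [m]. *)
Lemma divisor_sum_pfactor M chi p v m : real_character M chi -> prime p ->
  (0 < m)%N -> ~~ (p %| m)%N ->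
  divisor_sum chi (p ^ v * m) = (\sum_(i < v.+1) chi p ^+ i) * divisor_sum chi m.
Proof.
move=> H pr m0 ndiv; elim: v => [|v IH].
  by rewrite big_ord_recl big_ord0 expr0 addr0 mul1r mul1n.
rewrite big_ord_recr /= mulrDl -IH /divisor_sum.
have p0 := prime_gt0 pr.
have gt0 i : (0 < p ^ i * m)%N by rewrite muln_gt0 expn_gt0 p0.
rewrite (bigID (fun d => (d %| p ^ v * m)%N)) /=; congr (_ + _).
  rewrite -big_filter; apply: perm_big; apply: uniq_perm; rewrite ?filter_uniq ?divisors_uniq//.
  move=> d; rewrite mem_filter -!dvdn_divisors//; apply: andb_idr => D.
  by apply: dvdn_trans D _; rewrite expnS -mulnA dvdn_mull.
rewrite -big_filter big_distrr /=.
under [RHS]eq_bigr do rewrite -(rcharX _ _ H) -(rcharM H).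
rewrite -(big_map (fun e => (p ^ v.+1 * e)%N) xpredT).
apply: perm_big; apply: uniq_perm; rewrite ?filter_uniq ?divisors_uniq//.
  rewrite map_inj_uniq ?divisors_uniq// => x y /eqP.
  by rewrite eqn_pmul2l ?expn_gt0 ?p0// => /eqP.
move=> d; rewrite mem_filter -dvdn_divisors//; apply/andP/mapP => [[nd dd]|[e]].
  have d0 : (0 < d)%N by apply: dvdn_gt0 dd.
  have [e ncop de] := pfactor_coprime pr d0.
  have em : (e %| m)%N.
    have : (e %| p ^ v.+1 * m)%N by apply: dvdn_trans dd; rewrite de dvdn_mulr.
    by rewrite Gauss_dvdr// coprimeXr// coprime_sym.
  exists e; first by rewrite -dvdn_divisors.
  rewrite {1}de mulnC; congr (p ^ _ * e)%N; apply/eqP; rewrite eqn_leq.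
  have L : (logn p d <= v.+1)%N.
    have := dvdn_leq_log p (gt0 v.+1) dd.
    by rewrite lognM ?expn_gt0 ?p0// pfactorK// (_ : logn p m = 0%N) ?addn0//; apply/eqP; rewrite lognE pr m0 (negPf ndiv).
  rewrite L /= ltnNge; apply: contra nd => Lv.
  by rewrite de mulnC dvdn_mul// dvdn_exp2l.
rewrite -dvdn_divisors// => em ->; split; last by rewrite dvdn_mul.
rewrite expnSr -mulnA dvdn_pmul2l ?expn_gt0 ?p0//; apply: contra ndiv.
exact: dvdn_trans (dvdn_mulr _ _).
Qed.

(** The sum is [1], [v + 1] or the indicator of even [v], according as [chi p] is [0], [1] or
    [-1]. *)
Lemma geometric_sign M chi p v : real_character M chi ->
  [/\ 0 <= \sum_(i < v.+1) chi p ^+ i,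
      ~~ odd v -> 1 <= \sum_(i < v.+1) chi p ^+ i
    & odd v -> chi p != 1 -> chi p != 0 -> \sum_(i < v.+1) chi p ^+ i = 0].
Proof.
move=> /(rchar_val p) [] ->.
- have -> : \sum_(i < v.+1) (0 : int) ^+ i = 1.
    by rewrite big_ord_recl big1 ?addr0// => i _; rewrite expr0n.
  by [].
- under eq_bigr do rewrite expr1n.
  by rewrite sumr_const card_ord; split => //; lia.
have -> : \sum_(i < v.+1) (-1 : int) ^+ i = (~~ odd v)%:R.
  elim: v => [|v IH]; first by rewrite big_ord_recl big_ord0.
  by rewrite big_ord_recr /= IH -signr_odd /=; case: odd.
by case: odd.
Qed.

Lemma pfactor_split m : (1 < m)%N ->
  exists p v m', [/\ prime p, ~~ (p %| m')%N, (0 < m' < m)%N, (0 < v)%N & m = (p ^ v * m')%N].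
Proof.
move=> m1; have pr := pdiv_prime m1; have m0 : (0 < m)%N by apply: ltnW.
have [m' cop E] := pfactor_coprime pr m0.
have p1 := prime_gt1 pr.
have v0 : (0 < logn (pdiv m) m)%N by rewrite -pfactor_dvdn// expn1 pdiv_dvd.
exists (pdiv m), (logn (pdiv m) m), m'; split => //.
- by rewrite -prime_coprime.
- have m'0 : (0 < m')%N by move: m0; rewrite {1}E muln_gt0 => /andP[].
  rewrite m'0 [X in (_ < X)%N]E -{1}(muln1 m') ltn_pmul2l// -{1}(expn0 (pdiv m)).
  by rewrite ltn_exp2l.
- by rewrite mulnC.
Qed.

Lemma divisor_sum_ge0 M chi m : real_character M chi -> 0 <= divisor_sum chi m.
Proof.
move=> H; elim/ltn_ind: m => m IH.
have [m1|] := ltnP 1 m; last first.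
  by case: m {IH} => [|[|]]// _; rewrite /divisor_sum /= ?big_cons big_nil ?(rchar1 H).
have [p [v [m' [pr nd /andP[m'0 lt] v0 E]]]] := pfactor_split m1.
rewrite E (divisor_sum_pfactor _ H)// mulr_ge0 ?IH//.
by case: (geometric_sign p v H).
Qed.

Lemma divisor_sum_sqr M chi k : real_character M chi -> (0 < k)%N ->
  1 <= divisor_sum chi (k ^ 2).
Proof.
move=> H; elim/ltn_ind: k => k IH k0.
have [k1|k1] := ltnP 1 k; last first.
  have -> : k = 1%N by lia.
  by rewrite /divisor_sum /= big_cons big_nil (rchar1 H).
have [p [v [k' [pr nd /andP[k'0 lt] v0 E]]]] := pfactor_split k1.
rewrite E expnMn -expnM (divisor_sum_pfactor _ H) ?expn_gt0 ?k'0//; last first.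
  by rewrite Euclid_dvdX// negb_and nd.
have [_ h _] := geometric_sign p (v * 2) H.
have {h} := h _; rewrite oddM andbF => /(_ isT).
have := IH _ lt k'0; nia.
Qed.

Lemma dvdn_sqrD_mul p A K B1 B2 : coprime p A ->
  (p %| B1 ^ 2 + K)%N -> (A %| B2 ^ 2 + K)%N ->
  exists B, (p * A %| B ^ 2 + K)%N.
Proof.
move=> cop D1 D2.
have lift q x y : x = y %[mod q] -> (q %| y ^ 2 + K)%N -> (q %| x ^ 2 + K)%N.
  by move=> E; rewrite /dvdn -(modnDml (x ^ 2)) -(modnXm 2 q x) E modnXm modnDml.
exists (chinese p A B1 B2); rewrite Gauss_dvd//; apply/andP; split.
  exact: lift (chinese_modl cop _ _) D1.
exact: lift (chinese_modr cop _ _) D2.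
Qed.

(** By multiplicativity, a positive divisor sum excludes primes with [chi p = -1] and odd exponent.
    Each prime of odd exponent puts one factor into [A], everything else goes into [k ^ 2], and the
    square roots of [-K] are combined by the Chinese remainder theorem. *)
Lemma divisor_sum_gt0_split M chi K m : real_character M chi ->
  (forall p, prime p -> chi p = 1 -> exists b, (p %| b ^ 2 + K)%N) ->
  (0 < m)%N -> coprime m M -> 0 < divisor_sum chi m ->
  exists A k B, [/\ m = (k ^ 2 * A)%N, (A %| B ^ 2 + K)%N
    & forall p, prime p -> (p %| A)%N -> chi p = 1].
Proof.
move=> H HK; elim/ltn_ind: m => m IH m0 cop rm.
have [m1|m1] := ltnP 1 m; last first.
  exists 1%N, 1%N, 0%N; split; [lia|exact: dvd1n|].
  by move=> p pr; rewrite dvdn1 => /eqP e; have := prime_gt1 pr; lia.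
have [p [v [m' [pr nd /andP[m'0 lt] v0 E]]]] := pfactor_split m1.
move: rm; rewrite E (divisor_sum_pfactor _ H)// => rm.
have r' := divisor_sum_ge0 m' H.
have [g0 _ godd] := geometric_sign p v H.
have gpos : 0 < \sum_(i < v.+1) chi p ^+ i by nia.
have copm' : coprime m' M by apply: coprime_dvdl cop; rewrite E dvdn_mull.
have copp : coprime p M.
  by apply: coprime_dvdl cop; rewrite E dvdn_mulr// -{1}(expn1 p) dvdn_exp2l.
have [] := IH m' lt m'0 copm'; first nia.
move=> A [k [B [E' AB HA]]].
have [vo|ve] := boolP (odd v); last first.
  exists A, (p ^ v./2 * k)%N, B; split => //.
  by rewrite expnMn -expnM muln2 even_halfK// -mulnA -E'.
have chip : chi p = 1.
  apply/eqP/negPn/negP => n1; move: gpos; rewrite godd ?ltxx//.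
  by rewrite (rchar_eq0 H) copp.
have [b Hb] := HK p pr chip.
have copA : coprime p A.
  rewrite prime_coprime//; apply: contra nd => d; rewrite E'; exact: dvdn_mull.
have [B' HB'] := dvdn_sqrD_mul copA Hb AB.
exists (p * A)%N, (p ^ v./2 * k)%N, B'; split; [|exact: HB'|].
  have Ev : v = (v./2.*2).+1%N by rewrite -{1}(odd_double_half v) vo.
  by rewrite expnMn -expnM muln2 -mulnA (mulnCA (k ^ 2)%N) -E' mulnA -expnSr -Ev.
move=> q qr; rewrite Euclid_dvdM// => /orP[]; last exact: HA.
by rewrite dvdn_prime2// => /eqP->.
Qed.

(** * Unboundedness of [X * L_X] *)

Definition Lsum (chi : nat -> int) (X : nat) : rat :=
  \sum_(1 <= d < X.+1) (chi d)%:~R / d%:R.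

Lemma sum_multiples (F : nat -> rat) d X : (0 < d)%N ->
  \sum_(1 <= m < X.+1 | (d %| m)%N) F m = \sum_(1 <= e < (X %/ d).+1) F (d * e)%N.
Proof.
move=> d0; elim: X => [|X IH]; first by rewrite div0n !big_geq.
rewrite big_mkcond big_nat_recr //= -big_mkcond IH divnS//.
case: ifP => D; last by rewrite addr0.
rewrite add1n [RHS]big_nat_recr//=; congr (_ + _); congr (F _).
by rewrite -[(X %/ d).+1]add1n -{1}(divnK D) divnS// D mulnC.
Qed.

Lemma sum_divisors (chi : nat -> int) m X : (0 < m <= X)%N ->
  (divisor_sum chi m)%:~R = \sum_(1 <= d < X.+1 | (d %| m)%N) (chi d)%:~R :> rat.
Proof.
move=> /andP[m0 mX]; rewrite rmorph_sum /= -[RHS]big_filter; apply: perm_big.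
apply: uniq_perm; rewrite ?divisors_uniq ?filter_uniq ?iota_uniq// => d.
rewrite mem_filter mem_index_iota -dvdn_divisors//.
apply/esym; rewrite andbC; apply: andb_idl => D.
by rewrite (dvdn_gt0 m0 D) ltnS (leq_trans (dvdn_leq m0 D) mX).
Qed.

Lemma sum_divisor_sum (chi : nat -> int) (F : nat -> rat) X :
  \sum_(1 <= m < X.+1) (divisor_sum chi m)%:~R * F m =
  \sum_(1 <= d < X.+1) (chi d)%:~R * \sum_(1 <= e < (X %/ d).+1) F (d * e)%N.
Proof.
transitivity (\sum_(1 <= m < X.+1) \sum_(1 <= d < X.+1 | (d %| m)%N) (chi d)%:~R * F m).
  by apply: eq_big_nat => m mX; rewrite (sum_divisors _ mX) big_distrl.
under eq_bigr do rewrite big_mkcond.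
rewrite exchange_big_nat /=; apply: eq_big_nat => d /andP[d0 _].
by rewrite -big_mkcond /= -sum_multiples// big_distrr.
Qed.

(* The remainder term left by replacing [X %/ d] with [X / d] in the Cesaro mean;
   small near [d = 0] and Lipschitz in [d] elsewhere, so it averages out against chi. *)
Definition sawtooth (X d : nat) : rat :=
  (X %% d)%:R * (d%:R - (X %% d)%:R) / d%:R.

Lemma sum_arith (x y : rat) q :
  \sum_(1 <= e < q.+1) (x - y * e%:R) = q%:R * x - y * q%:R * (q%:R + 1) / 2.
Proof.
elim: q => [|q IH]; first by rewrite big_geq//; field.
by rewrite big_nat_recr//= IH -natr1; field.
Qed.

Lemma cesaro_identity M chi X : real_character M chi -> (M %| X)%N ->
  2 * \sum_(1 <= m < X.+1) (divisor_sum chi m)%:~R * (X%:R - m%:R) =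
  X%:R ^+ 2 * Lsum chi X + \sum_(1 <= d < X.+1) (chi d)%:~R * sawtooth X d :> rat.
Proof.
move=> H /dvdnP[t Ht].
rewrite (sum_divisor_sum chi (fun m => X%:R - m%:R)).
(* Twice the inner sum over [e] is [X ^ 2 / d - X + sawtooth X d]; the term [- X] disappears because
   [chi] sums to zero over whole periods. *)
have Z : \sum_(1 <= d < X.+1) (chi d)%:~R = 0 :> rat.
  rewrite -rmorph_sum /= -[X.+1]add1n [X in (1 + X)%N]Ht (rchar_sum_windows 1 t H); exact: mulr0z.
rewrite -[RHS]subr0 -[X in _ - X](mulr0 X%:R) -[X in _ - _ * X]Z !big_distrr -big_split -sumrB /=.
apply: eq_big_nat => d /andP[d0 _].
have dR : d%:R != 0 :> rat by rewrite pnatr_eq0 -lt0n.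
under eq_bigr do rewrite natrM.
rewrite sum_arith /sawtooth.
have -> : X%:R = (X %/ d)%:R * d%:R + (X %% d)%:R :> rat by rewrite {1}(divn_eq X d) natrD natrM.
by field.
Qed.

Lemma sawtooth_bounds X d : (0 < d)%N -> 0 <= sawtooth X d <= d%:R / 4.
Proof.
move=> d0; have dR : 0 < d%:R :> rat by rewrite ltr0n.
have r0 : 0 <= (X %% d)%:R :> rat by rewrite ler0n.
have rd : (X %% d)%:R <= d%:R :> rat by rewrite ler_nat ltnW// ltn_pmod.
rewrite /sawtooth; apply/andP; split.
  by rewrite divr_ge0 ?mulr_ge0 ?subr_ge0// ltW.
rewrite ler_pdivrMr//; have := sqr_ge0 (d%:R - 2 * (X %% d)%:R : rat); nra.
Qed.

(** Let [q] and [r] be quotient and remainder. If [q <= r], going to [d.+1] keeps the quotient and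
    lowers the remainder by [q]. Otherwise the remainder wraps around, and both values of the
    sawtooth lie between [0] and [q]. *)
Lemma sawtooth_lipschitz X d : (0 < d)%N -> (X %/ d <= d)%N ->
  `|sawtooth X d.+1 - sawtooth X d| <= (X %/ d)%:R + 1.
Proof.
move=> d0 qd; set q := (X %/ d)%N; set r := (X %% d)%N.
have rd : (r < d)%N := ltn_pmod X d0.
have EX : X = (q * d + r)%N := divn_eq X d.
have dR : 0 < d%:R :> rat by rewrite ltr0n.
have d1R : 0 < d%:R + 1 :> rat by lra.
have r0R : 0 <= r%:R :> rat by rewrite ler0n.
have q0R : 0 <= q%:R :> rat by rewrite ler0n.
have rdR : r%:R + 1 <= d%:R :> rat by rewrite natr1 ler_nat.
have dN : d%:R != 0 :> rat by rewrite gt_eqF.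
have d1N : d%:R + 1 != 0 :> rat by rewrite gt_eqF.
have [qr|rq] := leqP q r.
  have Emod : (X %% d.+1 = r - q)%N.
    have -> : X = (q * d.+1 + (r - q))%N by rewrite EX mulnS; lia.
    by rewrite modnMDl modn_small; lia.
  have qrR : q%:R <= r%:R :> rat by rewrite ler_nat.
  rewrite /sawtooth Emod -/r natrB// -natr1.
  pose u : rat := r%:R ^+ 2 / (d%:R * (d%:R + 1)); pose w : rat := (2 * r%:R * q%:R - q%:R ^+ 2) / (d%:R + 1).
  have -> : (r%:R - q%:R) * (d%:R + 1 - (r%:R - q%:R)) / (d%:R + 1) - r%:R * (d%:R - r%:R) / d%:R
    = u + w - q%:R :> rat by rewrite /u /w; field; rewrite dN d1N.
  have u0 : 0 <= u by rewrite divr_ge0 ?sqr_ge0// mulr_ge0 ?ltW.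
  have rr : r%:R * r%:R <= d%:R * d%:R :> rat by apply: ler_pM => //; lra.
  have u1 : u <= 1 by rewrite ler_pdivrMr ?mulr_gt0//; lra.
  have w0 : 0 <= w.
    apply: divr_ge0; last exact: ltW.
    have := mulr_ge0 q0R r0R; have := ler_wpM2l q0R qrR; lra.
  have w1 : w <= 2 * q%:R by rewrite ler_pdivrMr//; have := ler_wpM2l q0R rdR; have := mulr_ge0 q0R q0R; lra.
  by rewrite ler_norml; apply/andP; split; lra.
have Emod : (X %% d.+1 = d.+1 + r - q)%N.
  have -> : X = (q.-1 * d.+1 + (d.+1 + r - q))%N by rewrite EX; nia.
  by rewrite modnMDl modn_small; lia.
have rqR : r%:R <= q%:R :> rat by rewrite ler_nat ltnW.
have qdR : q%:R <= d%:R :> rat by rewrite ler_nat.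
have := sawtooth_bounds X d0; have := sawtooth_bounds X (ltn0Sn d).
rewrite /sawtooth Emod -/r natrB; last by lia.
rewrite natrD -natr1.
set A := _ / (d%:R + 1); set B := _ / d%:R => /andP[A0 _] /andP[B0 _].
have A1 : A <= q%:R by rewrite ler_pdivrMr//; nra.
have B1 : B <= q%:R by rewrite ler_pdivrMr//; nra.
by rewrite ler_norml; apply/andP; split; lra.
Qed.

Lemma lipschitz_nat (F : nat -> rat) K s n :
  (forall i, (s <= i < s + n)%N -> `|F i.+1 - F i| <= K) ->
  `|F (s + n)%N - F s| <= n%:R * K.
Proof.
elim: n => [|n IH] HF; first by rewrite addn0 subrr normr0 mul0r.
rewrite -natr1 mulrDl mul1r addnS.
have -> : F (s + n).+1 - F s = (F (s + n)%N - F s) + (F (s + n).+1 - F (s + n)%N) by ring.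
apply: le_trans (ler_normD _ _) _; apply: lerD.
  by apply: IH => i /andP[si isn]; apply: HF; rewrite si /= addnS ltnS ltnW.
by apply: HF; rewrite leq_addr addnS ltnSn.
Qed.

(** Since [chi] sums to zero over the window, [F d] may be replaced by [F d - F s], which is at most
    [M * K] in absolute value. *)
Lemma rchar_window_bound M chi (F : nat -> rat) K s : real_character M chi ->
  (forall i, (s <= i < s + M)%N -> `|F i.+1 - F i| <= K) ->
  `|\sum_(s <= d < s + M) (chi d)%:~R * F d| <= M%:R * (M%:R * K).
Proof.
move=> H HF; have M0 := rchar_gt0 H.
have K0 : 0 <= K.
  by apply: le_trans (normr_ge0 _) (HF s _); rewrite leqnn; lia.
have -> : \sum_(s <= d < s + M) (chi d)%:~R * F d =
    \sum_(s <= d < s + M) (chi d)%:~R * (F d - F s).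
  under [RHS]eq_bigr do rewrite mulrBr.
  rewrite sumrB -big_distrl /= -rmorph_sum /= (rchar_sum_window s H); by rewrite mul0r subr0.
apply: le_trans (ler_norm_sum _ _ _) _.
apply: (@le_trans _ _ (\sum_(s <= d < s + M) M%:R * K)); last first.
  by rewrite sumr_const_nat addKn -[X in X <= _]mulr_natl.
apply: ler_sum_nat => d /andP[sd dM]; rewrite normrM -intr_norm.
apply: (@le_trans _ _ (1 * `|F d - F s|)).
  by rewrite ler_wpM2r// (_ : 1 = 1%:~R)// ler_int (rchar_norm _ H).
rewrite mul1r -(subnKC sd).
apply: le_trans (lipschitz_nat (K := K) _) _ => [i /andP[si id]|].
  by apply: HF; rewrite si /=; lia.
by rewrite ler_wpM2r// ler_nat; lia.
Qed.

Lemma rchar_windows_bound M chi (F : nat -> rat) K s t : real_character M chi ->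
  (forall i, (s <= i < s + t * M)%N -> `|F i.+1 - F i| <= K) ->
  `|\sum_(s <= d < s + t * M) (chi d)%:~R * F d| <= t%:R * (M%:R * (M%:R * K)).
Proof.
move=> H; elim: t => [|t IH] HF; first by rewrite addn0 big_geq// normr0 mul0r.
rewrite mulSnr addnA (@big_cat_nat _ _ _ (s + t * M)) /= ?leq_addr//.
rewrite -natr1 mulrDl mul1r; apply: le_trans (ler_normD _ _) _; apply: lerD.
  by apply: IH => i /andP[si iM]; apply: HF; rewrite si mulSnr; lia.
by apply: rchar_window_bound => // i /andP[si iM]; apply: HF; rewrite mulSnr; lia.
Qed.

Lemma sum_squares_le (F : nat -> rat) Y : (forall m, (m <= Y ^ 2)%N -> 0 <= F m) ->
  \sum_(1 <= k < Y.+1) F (k ^ 2)%N <= \sum_(1 <= m < (Y ^ 2).+1) F m.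
Proof.
elim: Y => [|Y IH] F0; first by rewrite !big_geq.
have lt : (Y ^ 2 < Y.+1 ^ 2)%N by rewrite ltn_exp2r.
rewrite big_nat_recr//= [X in _ <= X](@big_cat_nat _ _ _ (Y ^ 2).+1)//=; last exact: ltnW.
apply: lerD; first by apply: IH => m mY; apply: F0; lia.
rewrite big_nat_recr//= lerDr big_nat; apply: sumr_ge0 => m /andP[_ mY]; apply: F0; lia.
Qed.

(* Trivial bound up to [8 M Y], cancellation over windows of length [M] beyond. *)
Lemma sawtooth_sum_bound M chi Y : real_character M chi -> (M %| Y)%N -> (8 * M <= Y)%N ->
  `|\sum_(1 <= d < (Y ^ 2).+1) (chi d)%:~R * sawtooth (Y ^ 2) d| <=
  Y%:R ^+ 3 / 8 + (16 * M%:R ^+ 2 + M%:R) * Y%:R ^+ 2.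
Proof.
move=> H /dvdnP[s Es] MY; have M0 := rchar_gt0 H.
set X := (Y ^ 2)%N; pose D := (8 * M * Y)%N; pose t := ((Y - 8 * M) * s)%N.
have EX : X.+1 = (D.+1 + t * M)%N.
  by rewrite /X /D /t -[(_ * s * M)%N]mulnA -Es -mulnn addSn -mulnDl subnKC.
have Y0 : (0 < Y)%N by lia.
have M0R : 0 < M%:R :> rat by rewrite ltr0n.
have Y0R : 0 < Y%:R :> rat by rewrite ltr0n.
rewrite (@big_cat_nat _ _ _ D.+1) //=; last by rewrite EX leq_addr.
apply: le_trans (ler_normD _ _) _.
have head : `|\sum_(1 <= d < D.+1) (chi d)%:~R * sawtooth X d| <= 16 * M%:R ^+ 2 * Y%:R ^+ 2.
  apply: le_trans (ler_norm_sum _ _ _) _.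
  apply: (@le_trans _ _ (\sum_(1 <= d < D.+1) D%:R / 4)); last first.
    rewrite sumr_const_nat subn1 -[X in X <= _]mulr_natl /D /= !natrM; lra.
  apply: ler_sum_nat => d /andP[d0 dD]; rewrite normrM -intr_norm.
  have /andP[s0 s1] := sawtooth_bounds X d0.
  rewrite (ger0_norm s0).
  apply: (@le_trans _ _ (1 * sawtooth X d)).
    by rewrite ler_wpM2r// (_ : 1 = 1%:~R)// ler_int (rchar_norm _ H).
  rewrite mul1r; apply: le_trans s1 _.
  by rewrite ler_wpM2r// ler_nat -ltnS.
(* Beyond [D] the quotients are at most [Y / (8 * M)]. The factor 8 makes the leading error
   [Y ^ 3 / 8], well below the main term [4 * Y ^ 3 / 3] that the squares will supply. *)
have tail : `|\sum_(D.+1 <= d < X.+1) (chi d)%:~R * sawtooth X d| <=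
    t%:R * (M%:R * (M%:R * (Y%:R / (8 * M%:R) + 1))).
  rewrite EX; apply: (rchar_windows_bound H) => i /andP[Di _].
  have qi : (X %/ i * (8 * M) <= Y)%N.
    rewrite -(@leq_pmul2r Y)// mulnn -mulnA.
    apply: leq_trans (leq_trunc_div X i); rewrite leq_mul2l ltnW ?orbT//.
  have q8 : (X %/ i <= Y)%N by apply: leq_trans qi; rewrite leq_pmulr//; lia.
  apply: le_trans (sawtooth_lipschitz _ _) _.
  - by lia.
  - by apply: leq_trans q8 _; apply: leq_trans (ltnW Di); rewrite leq_pmull//; lia.
  rewrite lerD2r ler_pdivlMr ?mulr_gt0//.
  by rewrite -[8]/(8%:R) -!natrM ler_nat.
have tM : t%:R * M%:R <= Y%:R ^+ 2 :> rat.
  by rewrite -natrM -natrX ler_nat /t -mulnA -Es -mulnn leq_mul2r leq_subr orbT.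
have K0 : 0 <= M%:R * (Y%:R / (8 * M%:R) + 1) :> rat.
  by rewrite mulr_ge0 ?ltW// addr_gt0// divr_gt0// mulr_gt0.
have := ler_wpM2r K0 tM.
have -> : Y%:R ^+ 2 * (M%:R * (Y%:R / (8 * M%:R) + 1)) = Y%:R ^+ 3 / 8 + M%:R * Y%:R ^+ 2 :> rat.
  by field; rewrite gt_eqF.
move: head tail; set a := `|_|; set b := `|_|; lra.
Qed.

Lemma sum_square_gaps (x : rat) Y :
  \sum_(1 <= k < Y.+1) (x - (k ^ 2)%:R) =
  Y%:R * x - Y%:R * (Y%:R + 1) * (2 * Y%:R + 1) / 6.
Proof.
elim: Y => [|Y IH]; first by rewrite big_geq//; field.
by rewrite big_nat_recr//= IH natrX -natr1; field.
Qed.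

(** In the Cesaro mean up to [Y ^ 2] only the squares are kept, each with divisor sum at least 1.
    They give [4 * Y ^ 3 / 3] to leading order, which absorbs the sawtooth error and leaves [Y ^ 3]
    up to a multiple of [Y ^ 2]. *)
Lemma Lsum_lower M chi Y : real_character M chi -> (M %| Y)%N -> (8 * M <= Y)%N ->
  Y%:R - 20 * M%:R ^+ 2 <= Y%:R ^+ 2 * Lsum chi (Y ^ 2).
Proof.
move=> H MY MY8; have M0 := rchar_gt0 H.
have MX : (M %| Y ^ 2)%N by rewrite dvdn_exp.
have W := cesaro_identity H MX.
have := sawtooth_sum_bound H MY MY8.
move: W; set E := \sum_(_ <= d < _) _ * sawtooth _ _ => W EB.
have WB : \sum_(1 <= k < Y.+1) ((Y ^ 2)%:R - (k ^ 2)%:R) <=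
    \sum_(1 <= m < (Y ^ 2).+1) (divisor_sum chi m)%:~R * ((Y ^ 2)%:R - m%:R) :> rat.
  apply: le_trans (sum_squares_le _) => [|m mY].
    apply: ler_sum_nat => k /andP[k0 kY].
    rewrite -[X in X <= _]mul1r ler_wpM2r//.
      by rewrite subr_ge0 ler_nat leq_exp2r.
    by rewrite (_ : 1 = 1%:~R)// ler_int (divisor_sum_sqr H).
  by rewrite mulr_ge0 ?subr_ge0 ?ler_nat// ler0z (divisor_sum_ge0 _ H).
move: WB; rewrite sum_square_gaps.
move: W; rewrite !natrX; set L := Lsum _ _; set S := \sum_(_ <= m < _) _ => W WB.
have Y0 : 0 < Y%:R :> rat by rewrite ltr0n; lia.
have M1 : 1 <= M%:R :> rat by rewrite ler1n.
have MM : M%:R <= M%:R ^+ 2 :> rat by rewrite expr2 ler_peMl// ltW// (lt_le_trans _ M1).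
have YY : Y%:R <= Y%:R ^+ 2 :> rat by rewrite expr2 ler_peMl ?(ltW Y0)// ler1n; lia.
have Y2 : 0 < Y%:R ^+ 2 :> rat by rewrite exprn_gt0.
rewrite -(ler_pM2l Y2).
have := ler_norm E; have := ler_wpM2r (ltW Y2) MM; have := ler_wpM2r (ltW Y2) M1.
nra.
Qed.

(** * Divisor sums in a progression *)

Lemma count_residue M b T : (0 < b <= M)%N ->
  (\sum_(1 <= e < T.+1) (e == b %[mod M]) = (T + M - b) %/ M)%N.
Proof.
move=> /andP[b0 bM]; have M0 : (0 < M)%N := leq_trans b0 bM.
elim: T => [|T IH]; first by rewrite big_geq// divn_small//; lia.
rewrite big_nat_recr//= IH.
have -> : (T.+1 + M - b = (T + M - b).+1)%N by lia.
rewrite divnS// addnC; congr (nat_of_bool _ + _)%N.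
have -> : (T + M - b).+1 = (T.+1 + M - b)%N by lia.
rewrite -(modnDr T.+1) eqn_mod_dvd//; lia.
Qed.

Lemma coprime_solve d M a : coprime d M -> (0 < M)%N ->
  exists2 b, (0 < b <= M)%N & forall e, (d * e == a %[mod M]) = (e == b %[mod M]).
Proof.
move=> cop M0.
have [d0|d0] := posnP d.
  have M1 : M = 1%N by move: cop; rewrite d0 /coprime gcd0n => /eqP.
  by exists 1%N => [|e]; rewrite M1// !modn1.
have [[u v] /= uv] := coprimeP M d0 cop.
have {}uv : (d * u = v * M + 1)%N by lia.
have solve e c : (d * e == c %[mod M]) = (e == u * c %[mod M]).
  apply/eqP/eqP => E.
    by rewrite -modnMmr -E modnMmr mulnA [(u * d)%N]mulnC uv mulnDl mul1n mulnAC modnMDl.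
  by rewrite -modnMmr E modnMmr mulnA uv mulnDl mul1n mulnAC modnMDl.
(* The representative is taken in [1..M], as [count_residue] requires, so residue [0] becomes
   [M]. *)
have [z|z] := posnP ((u * a) %% M).
  by exists M => [|e]; rewrite ?M0 ?leqnn// solve modnn z.
exists ((u * a) %% M)%N => [|e]; last by rewrite solve modn_mod.
by rewrite z ltnW// ltn_pmod.
Qed.

Lemma count_solutions d M a T : coprime d M -> (0 < M)%N ->
  let c := (\sum_(1 <= e < T.+1) (d * e == a %[mod M]))%N in
  (T %/ M <= c <= T %/ M + 1)%N /\ ((M %| T)%N -> c = (T %/ M)%N).
Proof.
move=> cop M0 /=; have [b bM Eb] := coprime_solve a cop M0.
under eq_bigr do rewrite Eb.
rewrite count_residue//; split.
  apply/andP; split; first by apply: leq_div2r; lia.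
  apply: (@leq_trans ((T + M) %/ M)); first by apply: leq_div2r; lia.
  by rewrite divnDr// divnn M0.
move=> /dvdnP[t ->]; rewrite -addnBA; last by lia.
by rewrite divnMDl// mulnK// divn_small ?addn0//; lia.
Qed.

(** Among the pairs with [d * e <= Y ^ 2] at least one entry is at most [Y]. By symmetry the sum is
    twice the part with [d <= Y], minus the square where both are at most [Y], counted twice. *)
Lemma hyperbola (g : nat -> nat -> rat) Y : (forall d e, g d e = g e d) ->
  \sum_(1 <= d < (Y ^ 2).+1) \sum_(1 <= e < (Y ^ 2 %/ d).+1) g d e =
  \sum_(1 <= d < Y.+1)
    (2 * \sum_(1 <= e < (Y ^ 2 %/ d).+1) g d e - \sum_(1 <= e < Y.+1) g d e).
Proof.
move=> sym; set X := (Y ^ 2)%N.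
have YX : (Y <= X)%N by rewrite /X -mulnn; case: (Y) => // y; rewrite leq_pmull.
pose h d e := if (d * e <= X)%N then g d e else 0.
have hs d e : h d e = h e d by rewrite /h mulnC sym.
have inner d : (0 < d)%N -> \sum_(1 <= e < (X %/ d).+1) g d e = \sum_(1 <= e < X.+1) h d e.
  move=> d0; rewrite [RHS](@big_cat_nat _ _ _ (X %/ d).+1) ?ltnS ?leq_div//=.
  rewrite [X in _ = _ + X]big1_seq ?addr0.
    by apply: eq_big_nat => e /andP[e0 eX]; rewrite /h mulnC -leq_divRL// -ltnS eX.
  move=> e; rewrite mem_index_iota => /andP[_ /andP[eX _]].
  by rewrite /h mulnC -leq_divRL// leqNgt eX.
have small d : (d <= Y)%N -> \sum_(1 <= e < Y.+1) g d e = \sum_(1 <= e < Y.+1) h d e.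
  move=> dY; apply: eq_big_nat => e /andP[e0 eX].
  by rewrite /h /X -mulnn leq_mul.
transitivity (\sum_(1 <= d < X.+1) \sum_(1 <= e < X.+1) h d e).
  by apply: eq_big_nat => d /andP[d0 _]; exact: inner.
have -> : \sum_(1 <= d < Y.+1)
    (2 * \sum_(1 <= e < (X %/ d).+1) g d e - \sum_(1 <= e < Y.+1) g d e) =
    \sum_(1 <= d < Y.+1)
    (\sum_(1 <= e < X.+1) h d e + \sum_(Y.+1 <= e < X.+1) h d e).
  apply: eq_big_nat => d /andP[d0 dY]; rewrite inner// small//.
  by rewrite [\sum_(1 <= e < X.+1) _](@big_cat_nat _ _ _ Y.+1)//=; ring.
rewrite big_split /= (@big_cat_nat _ _ _ Y.+1)//=; congr (_ + _).
rewrite [RHS]exchange_big_nat /=; apply: eq_big_nat => d /andP[Yd dX].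
rewrite (@big_cat_nat _ _ _ Y.+1)//= [X in _ + X]big1_seq ?addr0.
  by apply: eq_bigr => e _.
move=> e; rewrite mem_index_iota => /andP[_ /andP[Ye _]].
by rewrite /h leqNgt /X -mulnn ltn_mul.
Qed.

(** The divisor sums are added over the [m <= Y ^ 2] congruent to [a]; the total is positive once
    [Y * Lsum chi Y] exceeds [M], so some term is positive. *)
Lemma rchar_progression M chi a : real_character M chi -> chi a = 1 ->
  exists m, [/\ (0 < m)%N, m = a %[mod M] & 0 < divisor_sum chi m].
Proof.
move=> H chia; have M0 := rchar_gt0 H.
have M1 : 1 <= M%:R :> rat by rewrite ler1n.
have [Y [Y0 MY HL]] : exists Y, [/\ (0 < Y)%N, (M %| Y)%N & M%:R < Y%:R * Lsum chi Y].
  (* [Lsum_lower] at [30 * M ^ 2] gives at least [10 * M ^ 2], which exceeds [M]. *)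
  exists ((30 * M * M) ^ 2)%N; split; first by rewrite expn_gt0 muln_gt0 muln_gt0 M0.
    by rewrite dvdn_exp// dvdn_mull.
  have := @Lsum_lower M chi (30 * M * M)%N H (dvdn_mull _ (dvdnn M)).
  rewrite natrX; set Z := _ * Lsum _ _; rewrite !natrM => /(_ _) B.
  have {B} := B _; have -> : (8 * M <= 30 * M * M)%N by nia.
  by move=> /(_ isT); nra.
pose ind m : rat := (m == a %[mod M])%:R.
suff S0 : 0 < \sum_(1 <= m < (Y ^ 2).+1) (divisor_sum chi m)%:~R * ind m.
  have [/hasP[m]|] := boolP (has (fun m => (m == a %[mod M]) && (0 < divisor_sum chi m))
    (index_iota 1 (Y ^ 2).+1)).
    by rewrite mem_index_iota => /andP[m0 _] /andP[/eqP E r]; exists m.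
  move=> /hasPn N; move: S0; rewrite big1_seq ?ltxx// => m /= /N.
  rewrite negb_and /ind => /orP[/negPf->|]; first by rewrite mulr0.
  rewrite -leNgt => r; have -> : divisor_sum chi m = 0 by apply/eqP; rewrite eq_le r (divisor_sum_ge0 _ H).
  by rewrite mul0r.
rewrite sum_divisor_sum.
pose g d e : rat := (chi d)%:~R * ind (d * e)%N.
(* If [d * e] is congruent to [a], then [chi d * chi e = 1], so the two signs agree; this is where
   [chi a = 1] enters. *)
have gs d e : g d e = g e d.
  rewrite /g mulnC /ind; case: eqP => E; last by rewrite !mulr0.
  congr (_%:~R * _); have : chi e * chi d = 1 by rewrite -(rcharM H) (rchar_mod H E).
  by case: (rchar_val d H) => ->; case: (rchar_val e H) => ->.
under eq_bigr do rewrite big_distrr /=.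
rewrite (hyperbola _ gs) sumrB.
(* As [M] divides [Y], every [d] coprime to [M] has exactly [Y / M] partners [e], and [chi] then
   sums to zero over [d]. *)
have -> : \sum_(1 <= d < Y.+1) \sum_(1 <= e < Y.+1) g d e = 0.
  transitivity ((Y %/ M)%:R * \sum_(1 <= d < Y.+1) (chi d)%:~R : rat).
    rewrite big_distrr; apply: eq_bigr => d _; rewrite -big_distrr /= mulrC.
    have [cop|ncop] := boolP (coprime d M); last first.
      by have -> : chi d = 0; [apply/eqP; rewrite (rchar_eq0 H)|rewrite !mulr0].
    congr (_ * _); have [_ /(_ MY) <-] := count_solutions a Y cop M0.
    by rewrite natr_sum.
  rewrite -rmorph_sum /= -(divnK MY) -[_.+1]add1n (rchar_sum_windows 1 _ H).
  exact: mulr0.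
rewrite subr0 -big_distrr /= mulr_gt0//.
have MR : 0 < M%:R :> rat by rewrite ltr0n.
have YR : 0 < Y%:R :> rat by rewrite ltr0n.
(* For [d] coprime to [M] the number of [e] is [Y ^ 2 / (M * d)] up to an error of 1, so the total
   error is at most [Y]. *)
suff : Y%:R ^+ 2 / M%:R * Lsum chi Y - Y%:R <= \sum_(1 <= d < Y.+1) \sum_(1 <= e < (Y ^ 2 %/ d).+1) g d e.
  apply: lt_le_trans; rewrite subr_gt0 mulrAC ltr_pdivlMr//.
  by rewrite expr2 -mulrA ltr_pM2l.
have EY : Y%:R = \sum_(1 <= d < Y.+1) 1 :> rat by rewrite sumr_const_nat subn1.
rewrite [X in _ - X <= _]EY {EY}.
rewrite /Lsum big_distrr -sumrB /=; apply: ler_sum_nat => d /andP[d0 dY].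
rewrite -big_distrr /=.
have [cop|ncop] := boolP (coprime d M); last first.
  by have -> : chi d = 0; [apply/eqP; rewrite (rchar_eq0 H)|rewrite !mul0r mulr0; lra].
have := count_solutions a (Y ^ 2 %/ d) cop M0.
rewrite /= -natr_sum; set c := \sum_(_ <= e < _) _ => -[/andP[c1 c2] _].
have q1 : (Y ^ 2 %/ d %/ M)%:R <= Y%:R ^+ 2 / M%:R / d%:R :> rat.
  rewrite !ler_pdivlMr ?ltr0n// -natrX -!natrM ler_nat mulnAC.
  by apply: leq_trans (leq_trunc_div _ d); rewrite leq_mul2r leq_trunc_div orbT.
have q2 : Y%:R ^+ 2 / M%:R / d%:R <= (Y ^ 2 %/ d %/ M)%:R + 1 :> rat.
  rewrite !ler_pdivrMr ?ltr0n// natr1 -natrX -!natrM ler_nat -divnMA.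
  by rewrite -mulnA ltnW// ltn_ceil// muln_gt0 d0.
have {}c1 : (Y ^ 2 %/ d %/ M)%:R <= c%:R :> rat by rewrite ler_nat.
have {}c2 : c%:R <= (Y ^ 2 %/ d %/ M)%:R + 1 :> rat by rewrite natr1 ler_nat -addn1.
move: q1 q2 c1 c2; set q := (_ %/ _ %/ _)%:R.
have -> : Y%:R ^+ 2 / M%:R * ((chi d)%:~R / d%:R) = (chi d)%:~R * (Y%:R ^+ 2 / M%:R / d%:R) :> rat by ring.
by set z := _ / M%:R / _; case: (rchar_val d H) => ->; lra.
Qed.

(** * Ternary forms of determinant 1 and 3 *)

(** The form with Gram matrix rows [(a, r, q)], [(r, b, p)], [(q, p, c)]. *)
Definition represents (a b c p q r n : int) : Prop :=
  exists x y z : int,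
    n = a * x ^+ 2 + b * y ^+ 2 + c * z ^+ 2 + 2 * p * y * z + 2 * q * x * z + 2 * r * x * y.

Lemma represents_shift32 (k a b c p q r n : int) :
  represents a b (c + 2 * k * p + k ^+ 2 * b) (p + k * b) (q + k * r) r n <->
  represents a b c p q r n.
Proof.
split=> -[x [y [z ->]]]; first by exists x, (y + k * z), z; ring.
by exists x, (y - k * z), z; ring.
Qed.

Lemma represents_shift21 (k a b c p q r n : int) :
  represents a (b + 2 * k * r + k ^+ 2 * a) c (p + k * q) q (r + k * a) n <->
  represents a b c p q r n.
Proof.
split=> -[x [y [z ->]]]; first by exists (x + k * y), y, z; ring.
by exists (x - k * y), y, z; ring.
Qed.

Lemma represents_swap23 a b c p q r n :
  represents a c b p r q n <-> represents a b c p q r n.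
Proof. by split=> -[x [y [z ->]]]; exists x, z, y; ring. Qed.

Lemma represents_swap12 a b c p q r n :
  represents b a c q p r n <-> represents a b c p q r n.
Proof. by split=> -[x [y [z ->]]]; exists y, x, z; ring. Qed.

Lemma represents_split (b c p q r n : int) :
  represents 1 (b - r ^+ 2) (c - q ^+ 2) (p - q * r) 0 0 n <-> represents 1 b c p q r n.
Proof.
split=> -[x [y [z ->]]]; first by exists (x - r * y - q * z), y, z; ring.
by exists (x + r * y + q * z), y, z; ring.
Qed.

Lemma nearest_multiple (b a : int) : 0 < a -> exists k, - a <= 2 * (b + k * a) <= a.
Proof.
move=> a0; exists (- ((2 * b + a) %/ (2 * a))%Z).
have := divz_eq (2 * b + a) (2 * a).
have := modz_ge0 (2 * b + a) (_ : 2 * a != 0).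
have := ltz_mod (2 * b + a) (_ : 2 * a != 0).
set m := (_ %% _)%Z; set d := (_ %/ _)%Z => /(_ _) H1 /(_ _) H2 H3.
have {}H1 : m < 2 * a by rewrite gtr0_norm in H1; [apply: H1; lia | lia].
have {}H2 : 0 <= m by apply: H2; lia.
by apply/andP; split; nia.
Qed.

(** From [u ^ 2 <= u * w = v ^ 2 + d] and [4 * v ^ 2 <= u ^ 2]. *)
Lemma reduced_bound (u w v d : int) : 0 < u -> u <= w -> u * w = v ^+ 2 + d ->
  - u <= 2 * v <= u -> 3 * u ^+ 2 <= 4 * d.
Proof.
move=> u0 uw E /andP[v1 v2].
have := ler_wpM2l (ltW u0) uw.
have : 0 <= (u - 2 * v) * (u + 2 * v) by rewrite mulr_ge0//; lia.
rewrite !expr2 in E *; lia.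
Qed.

(* Hermite's bound a^3 <= 64 D / 27 with D <= 3 leaves only a = 1. *)
Lemma hermite_eq1 (a u D : int) : 0 < a -> 0 < u -> D <= 3 ->
  3 * a ^+ 2 <= 4 * u -> 3 * u ^+ 2 <= 4 * (a * D) -> a = 1.
Proof.
rewrite !expr2 => a0 u0 D3 h1 h2; suff : a < 2 by lia.
rewrite ltNge; apply/negP=> a2.
have h3 : 3 * a <= 2 * u by have := ler_wpM2r (ltW a0) a2; lia.
have h4 := ler_wpM2l (ltW u0) h3.
have h5 := ler_wpM2l (ltW a0) D3.
have h6 := ler_wpM2l (ltW a0) h3.
have h7 := ler_wpM2l (ltW a0) a2.
lia.
Qed.

Lemma absz_descent (x y : int) m : 0 < x < y -> (absz y < m.+1)%N -> (absz x < m)%N.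
Proof. lia. Qed.

(** Nested descent, outside on [a] and inside on the minor [a * b - r ^ 2], alternately reducing the
    binary form [(a, r, b)] and a binary form built from [2 x 2] minors. When neither swap lowers
    anything, Hermite's bound gives [a = 1], and a unit vector splits off. *)
Lemma ternary_split (a b c p q r D : int) : 0 < D <= 3 -> 0 < a -> 0 < a * b - r ^+ 2 ->
  a * b * c + 2 * p * q * r - a * p ^+ 2 - b * q ^+ 2 - c * r ^+ 2 = D ->
  exists b' c' p' : int, [/\ 0 < b', b' * c' - p' ^+ 2 = D &
    forall n, represents a b c p q r n <-> represents 1 b' c' p' 0 0 n].
Proof.
move=> D3.
have [m] := ubnP `|a|%N; elim: m => // m IHm in a b c p q r *.
have [l] := ubnP (absz (a * b - r ^+ 2)%R); elim: l => // l IHl in b c p q r *.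
move=> al am a0 al0 det.
have [k Hk] := nearest_multiple (a * p - q * r) al0.
pose c1 := c + 2 * k * p + k ^+ 2 * b; pose p1 := p + k * b; pose q1 := q + k * r.
have det1 : a * b * c1 + 2 * p1 * q1 * r - a * p1 ^+ 2 - b * q1 ^+ 2 - c1 * r ^+ 2 = D.
  by rewrite -det /c1 /p1 /q1; ring.
have Hk1 : - (a * b - r ^+ 2) <= 2 * (a * p1 - q1 * r) <= a * b - r ^+ 2.
  by rewrite (_ : a * p1 - q1 * r = a * p - q * r + k * (a * b - r ^+ 2)) // /p1 /q1; ring.
have R1 n : represents a b c1 p1 q1 r n <-> represents a b c p q r n.
  exact: represents_shift32.
(* The binary form of minors has determinant [a * D]; the shift by [k] has reduced its middle
   coefficient. *)
have disc : (a * b - r ^+ 2) * (a * c1 - q1 ^+ 2) = (a * p1 - q1 * r) ^+ 2 + a * D.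
  by rewrite -det1; ring.
move: (c1) (p1) (q1) det1 Hk1 R1 disc => {det Hk}c' p' q' det Hk R disc {c1 p1 q1 k}.
move: disc Hk; set al' := a * b - r ^+ 2 in al al0 *; set ga := a * c' - q' ^+ 2; set be := a * p' - _ => disc Hk.
have ga0 : 0 < ga.
  have : 0 < al' * ga by rewrite disc ltr_wpDl ?sqr_ge0// mulr_gt0//; lia.
  by rewrite pmulr_rgt0.
have [lt|ge] := ltP ga al'.
  have [] := IHl c' b p' r q' _ am a0 ga0.
  - by apply: absz_descent al; rewrite ga0 lt.
  - by rewrite -det; ring.
  move=> b2 [c2 [p2 [b20 D2 H2]]]; exists b2, c2, p2; split=> // n.
  exact: iff_trans (iff_sym (R n)) (iff_trans (iff_sym (represents_swap23 _ _ _ _ _ _ _)) (H2 n)).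
have hermite := reduced_bound al0 ge disc Hk.
have [j Hk2] := nearest_multiple r a0.
pose b1 := b + 2 * j * r + j ^+ 2 * a; pose r1 := r + j * a; pose p1 := p' + j * q'.
have det1 : a * b1 * c' + 2 * p1 * q' * r1 - a * p1 ^+ 2 - b1 * q' ^+ 2 - c' * r1 ^+ 2 = D.
  by rewrite -det /b1 /r1 /p1; ring.
have al1 : a * b1 = al' + r1 ^+ 2 by rewrite /b1 /r1 /al'; ring.
have R1 n : represents a b1 c' p1 q' r1 n <-> represents a b c p q r n.
  exact: iff_trans (represents_shift21 _ _ _ _ _ _ _ _) (R n).
have Hk3 : - a <= 2 * r1 <= a by [].
move: (b1) (p1) (r1) det1 al1 R1 Hk3 => b2 p2 r2 det2 al2 R2 Hr2.
have b20 : 0 < b2 by rewrite -(pmulr_rgt0 _ a0) al2 ltr_wpDr ?sqr_ge0.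
have [lt|ge2] := ltP b2 a.
  have [] := IHm b2 a c' q' p2 r2 _ b20.
  - by apply: absz_descent am; rewrite b20 lt.
  - by rewrite mulrC al2 addrK.
  - by rewrite -det2; ring.
  move=> b3 [c3 [p3 [b30 D4 H3]]]; exists b3, c3, p3; split=> // n.
  exact: iff_trans (iff_sym (R2 n)) (iff_trans (iff_sym (represents_swap12 _ _ _ _ _ _ _)) (H3 n)).
have aa : 3 * a ^+ 2 <= 4 * al'.
  by apply: reduced_bound a0 ge2 _ Hr2; rewrite al2 addrC.
have D3' : D <= 3 by case/andP: D3.
have a1 := hermite_eq1 a0 al0 D3' aa hermite.
move: al2 det2 R2; rewrite a1 => al2 det2 R2.
exists (b2 - r2 ^+ 2), (c' - q' ^+ 2), (p2 - q' * r2); split.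
- by rewrite -[b2]mul1r al2 addrK.
- by rewrite -det2; ring.
by move=> n; exact: iff_trans (iff_sym (R2 n)) (iff_sym (represents_split _ _ _ _ _ _)).
Qed.

Lemma binary_reduce (b c p D : int) : 0 < b -> b * c - p ^+ 2 = D -> 0 < D ->
  exists b' c' p' : int, [/\ 0 < b', b' * c' - p' ^+ 2 = D, - b' <= 2 * p' <= b', b' <= c' &
    forall n, represents 1 b c p 0 0 n <-> represents 1 b' c' p' 0 0 n].
Proof.
have [m] := ubnP `|b|%N; elim: m => // m IHm in b c p *.
move=> bm b0 det D0.
have [k Hk] := nearest_multiple p b0.
have det1 : b * (c + 2 * k * p + k ^+ 2 * b) - (p + k * b) ^+ 2 = D by rewrite -det; ring.
have R1 n : represents 1 b (c + 2 * k * p + k ^+ 2 * b) (p + k * b) 0 0 n <-> represents 1 b c p 0 0 n.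
  by have := represents_shift32 k 1 b c p 0 0 n; rewrite mulr0 addr0.
move: (c + _ + _) (p + _) det1 Hk R1 => c1 p1 det1 Hk R1.
have [lt|ge] := ltP c1 b; last by exists b, c1, p1; split=> // n; exact: iff_sym (R1 n).
have c10 : 0 < c1.
  by rewrite -(pmulr_rgt0 _ b0) (_ : b * c1 = p1 ^+ 2 + D) ?ltr_wpDl ?sqr_ge0// -det1; ring.
have [] := IHm c1 b p1 _ c10 _ D0; [by apply: absz_descent bm; rewrite c10 lt|by rewrite -det1; ring|].
move=> b2 [c2 [p2 [b20 D2 H2 H3 H4]]]; exists b2, c2, p2; split=> // n.
exact: iff_trans (iff_sym (R1 n)) (iff_trans (iff_sym (represents_swap23 _ _ _ _ _ _ _)) (H4 n)).
Qed.

Lemma ternary_det1 (a b c p q r n : int) : 0 < a -> 0 < a * b - r ^+ 2 ->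
  a * b * c + 2 * p * q * r - a * p ^+ 2 - b * q ^+ 2 - c * r ^+ 2 = 1 ->
  represents a b c p q r n -> exists x y z : int, n = x ^+ 2 + y ^+ 2 + z ^+ 2.
Proof.
move=> a0 al0 det.
have [|b1 [c1 [p1 [b10 det1 R]]]] := ternary_split _ a0 al0 det; first by [].
have [b2 [c2 [p2 [b20 det2 Hp Hb R2]]]] := binary_reduce b10 det1 isT.
rewrite R R2 => -[x [y [z ->]]]; exists x, y, z.
have b2E : b2 = 1.
  have E : b2 * c2 = p2 ^+ 2 + 1 by rewrite -det2; ring.
  by have := reduced_bound b20 Hb E Hp; clear -b20; rewrite expr2; nia.
have p2E : p2 = 0 by lia.
have c2E : c2 = 1 by move: det2; rewrite b2E p2E; lia.
by rewrite b2E c2E p2E; ring.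
Qed.

(* A positive ternary lattice of determinant 3 is either <1,1,3> or <1> + A2,
   and the latter represents 6 = 2^2 + 2. *)
Lemma ternary_det3 (a b c p q r n : int) : 0 < a -> 0 < a * b - r ^+ 2 ->
  a * b * c + 2 * p * q * r - a * p ^+ 2 - b * q ^+ 2 - c * r ^+ 2 = 3 ->
  ~ represents a b c p q r 6 ->
  represents a b c p q r n -> exists x y z : int, n = x ^+ 2 + y ^+ 2 + 3 * z ^+ 2.
Proof.
move=> a0 al0 det.
have [|b1 [c1 [p1 [b10 det1 R]]]] := ternary_split _ a0 al0 det; first by [].
have [b2 [c2 [p2 [b20 det2 Hp Hb R2]]]] := binary_reduce b10 det1 isT.
rewrite !R !R2 => N6 [x [y [z ->]]].
have b2E : b2 = 1 \/ b2 = 2.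
  have E : b2 * c2 = p2 ^+ 2 + 3 by rewrite -det2; ring.
  by have := reduced_bound b20 Hb E Hp; clear -b20; rewrite expr2; nia.
case: b2E => b2E; last first.
  by case: N6; exists 2, 1, 0; rewrite b2E; ring.
have p2E : p2 = 0 by lia.
have c2E : c2 = 3 by move: det2; rewrite b2E p2E; lia.
by exists x, y, z; rewrite b2E c2E p2E; ring.
Qed.

(** * The glued ternary form *)

Lemma sqr_mod3 (x : int) : exists q, x = 3 * q \/ x ^+ 2 = 3 * q + 1.
Proof.
have [q [->|[->|->]]] : exists q : int, x = 3 * q \/ (x = 3 * q + 1 \/ x = 3 * q - 1).
- have := divz_eq x 3; set q := (x %/ 3)%Z => E.
  have := ltz_mod x (isT : 3 != 0 :> int); have := modz_ge0 x (isT : 3 != 0 :> int).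
  case: (ltP (modz x 3) 2) => *; first by exists q; lia.
  by exists (q + 1); lia.
- by exists q; left.
- by exists (3 * q ^+ 2 + 2 * q); right; ring.
by exists (3 * q ^+ 2 - 2 * q); right; ring.
Qed.

Lemma sum_sqr_mod3 (x y m : int) : x ^+ 2 + y ^+ 2 = 3 * m ->
  exists u v, x = 3 * u /\ y = 3 * v.
Proof.
have [u [->|Eu]] := sqr_mod3 x; have [v [->|Ev]] := sqr_mod3 y; [by exists u, v|rewrite ?exprMn; lia..].
Qed.

Lemma int_mod3_eq1 (n : nat) : n = 1 %[mod 3] -> exists q : int, n%:Z = 3 * q + 1.
Proof. by move=> n1; exists (n %/ 3)%N; lia. Qed.

(* With [l = k (A x + B y) + N z] the form below is
   (d l^2 + (A x + B y)^2 / A + e N y^2 / A) / N, a lattice glued from the binary form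
   [A, B, C] and a vector of norm [d N]. *)
Lemma glue_identity (A B C N k j d e x y z : int) :
  A * C = B ^+ 2 + e * N -> N * j = d * A * k ^+ 2 + 1 ->
  N * A * (A * j * x ^+ 2 + (j * C - e * d * k ^+ 2) * y ^+ 2 + d * N * z ^+ 2
    + 2 * (d * k * B) * y * z + 2 * (d * k * A) * x * z + 2 * (B * j) * x * y) =
  d * A * (k * (A * x + B * y) + N * z) ^+ 2 + (A * x + B * y) ^+ 2 + e * N * y ^+ 2.
Proof.
move=> HC Hj.
transitivity ((N * j) * (A ^+ 2 * x ^+ 2 + (A * C) * y ^+ 2 + 2 * A * B * x * y)
  + N * A * (- e * d * k ^+ 2 * y ^+ 2 + d * N * z ^+ 2
    + 2 * (d * k * B) * y * z + 2 * (d * k * A) * x * z)); first by ring.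
by rewrite HC Hj; ring.
Qed.

(** All minors collapse through [A * b = j * B ^ 2 + e]; the value [d * N] is taken at
    [(0, 0, 1)]. *)
Lemma glue_form (A B C N k j d e : int) : 0 < A -> 0 < N -> 0 < j -> 0 < e ->
  A * C = B ^+ 2 + e * N -> N * j = d * A * k ^+ 2 + 1 ->
  let b := j * C - e * d * k ^+ 2 in
  [/\ 0 < A * j, 0 < A * j * b - (B * j) ^+ 2,
    A * j * b * (d * N) + 2 * (d * k * B) * (d * k * A) * (B * j) - A * j * (d * k * B) ^+ 2
      - b * (d * k * A) ^+ 2 - d * N * (B * j) ^+ 2 = d * e
    & represents (A * j) b (d * N) (d * k * B) (d * k * A) (B * j) (d * N)].
Proof.
move=> A0 N0 j0 e0 HC Hj b.
have Ab : A * b = j * B ^+ 2 + e.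
  transitivity (j * (A * C) - e * (d * A * k ^+ 2)); first by rewrite /b; ring.
  have -> : d * A * k ^+ 2 = N * j - 1 by rewrite Hj addrK.
  by rewrite HC; ring.
have disc : A * j * b - (B * j) ^+ 2 = j * e.
  by rewrite mulrAC Ab; ring.
split; [exact: mulr_gt0|by rewrite disc mulr_gt0| |by exists 0, 0, 1; ring].
transitivity (d * (N * j) * (A * b - j * B ^+ 2) - d ^+ 2 * k ^+ 2 * A * (A * b - j * B ^+ 2)).
  by ring.
by rewrite Ab Hj; ring.
Qed.

Lemma int_cofactor (a b : nat) : (a %| b)%N -> exists c : int, a%:Z * c = b%:Z.
Proof. by move=> /dvdnP[q ->]; exists q; rewrite mulrC. Qed.

Lemma glue_three_squares (A B k N : nat) : (0 < A)%N -> (0 < N)%N ->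
  (A %| B ^ 2 + N)%N -> (N %| A * k ^ 2 + 1)%N ->
  exists x y z : int, N%:Z = x ^+ 2 + y ^+ 2 + z ^+ 2.
Proof.
move=> A0 N0 /int_cofactor[C HC] /int_cofactor[j Hj].
have HC' : A%:Z * C = B%:Z ^+ 2 + 1 * N%:Z by rewrite HC; lia.
have Hj' : N%:Z * j = 1 * A%:Z * k%:Z ^+ 2 + 1 by rewrite Hj; lia.
have j0 : 0 < j by nia.
have [] := glue_form _ _ j0 _ HC' Hj'; rewrite ?ltz_nat//.
rewrite !mul1r; exact: ternary_det1.
Qed.

(** Through [glue_identity] this rules out the value 6 for [d = 1], [e = 3]. Modulo 3 an equality
    forces 3 to divide [l] and [w]; dividing by 3 would leave [y ^ 2] congruent to 2. *)
Lemma not_six_1_1_3 (n a l w y : int) :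
  (3 * n + 1) * (3 * a + 1) * 6 <>
  1 * (3 * a + 1) * l ^+ 2 + w ^+ 2 + 3 * (3 * n + 1) * y ^+ 2.
Proof.
move=> E; have [] := @sum_sqr_mod3 l w
  (2 * (3 * n + 1) * (3 * a + 1) - a * l ^+ 2 - (3 * n + 1) * y ^+ 2).
  rewrite -[w ^+ 2](addKr (1 * (3 * a + 1) * l ^+ 2)).
  have -> : 1 * (3 * a + 1) * l ^+ 2 + w ^+ 2 =
    (3 * n + 1) * (3 * a + 1) * 6 - 3 * (3 * n + 1) * y ^+ 2 by rewrite E; ring.
  by ring.
move=> u [v [Eu Ev]]; rewrite {}Eu {}Ev in E.
have [q [Eq|Eq]] := sqr_mod3 y; rewrite Eq in E; lia.
Qed.

(** The analogue for [d = 3], [e = 1]. The hypothesis makes [a] prime to 3, since [-1] is not a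
    square modulo 3; then 3 divides [w] and [y], and [l ^ 2] would be congruent to 2. *)
Lemma not_six_3_3_1 (n a b c l w y : int) :
  a * c = b ^+ 2 + 1 * (3 * n + 1) ->
  (3 * n + 1) * a * 6 <> 3 * a * l ^+ 2 + w ^+ 2 + 1 * (3 * n + 1) * y ^+ 2.
Proof.
move=> Hc.
have a3 m : a <> 3 * m.
  move=> Ea; rewrite Ea in Hc.
  by have [q [Eq|Eq]] := sqr_mod3 b; rewrite Eq in Hc; lia.
move=> {Hc}E; have [] := @sum_sqr_mod3 w y
  (2 * (3 * n + 1) * a - a * l ^+ 2 - n * y ^+ 2).
  rewrite -[w ^+ 2](addKr (3 * a * l ^+ 2)).
  have -> : 3 * a * l ^+ 2 + w ^+ 2 =
    (3 * n + 1) * a * 6 - 1 * (3 * n + 1) * y ^+ 2 by rewrite E; ring.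
  by ring.
move=> u [v [Eu Ev]]; rewrite {}Eu {}Ev in E.
have [q [Eq|Eq]] := sqr_mod3 l; rewrite Eq in E.
  by apply: (a3 (a - 3 * a * q ^+ 2 - u ^+ 2 - (3 * n + 1) * v ^+ 2 + 2 * a * n)); lia.
by apply: (a3 (a * q + u ^+ 2 + (3 * n + 1) * v ^+ 2 - 2 * a * n)); lia.
Qed.

Lemma glue_1_1_3 (A B k N : nat) : (0 < A)%N -> (0 < N)%N ->
  (A %| B ^ 2 + 3 * N)%N -> (N %| A * k ^ 2 + 1)%N ->
  A = 1 %[mod 3] -> N = 1 %[mod 3] ->
  exists x y z : int, N%:Z = x ^+ 2 + y ^+ 2 + 3 * z ^+ 2.
Proof.
move=> A0 N0 /int_cofactor[C HC] /int_cofactor[j Hj] A1 N1.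
have HC' : A%:Z * C = B%:Z ^+ 2 + 3 * N%:Z by rewrite HC; lia.
have Hj' : N%:Z * j = 1 * A%:Z * k%:Z ^+ 2 + 1 by rewrite Hj; lia.
have j0 : 0 < j by nia.
have [] := glue_form _ _ j0 _ HC' Hj'; rewrite ?ltz_nat// => a0 al0 det R.
have := ternary_det3 a0 al0 det _ R; rewrite mul1r; apply.
move=> [x [y [z E]]].
have := glue_identity x y z HC' Hj'; rewrite [1 * N%:Z]mul1r -E.
set l := _ + N%:Z * z; set w := _ + B%:Z * y; move: l w => l w.
have [a Ea] := int_mod3_eq1 A1.
have [n En] := int_mod3_eq1 N1.
rewrite Ea En; exact: not_six_1_1_3.
Qed.

(** With [d = 3] the glued form represents [3 * N]. In [3 * N = x ^ 2 + y ^ 2 + 3 * z ^ 2] both [x]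
    and [y] are multiples of 3, and dividing by 3 turns the diagonal form [1, 1, 3] into
    [3, 3, 1]. *)
Lemma glue_3_3_1 (A B k N : nat) : (0 < A)%N -> (0 < N)%N ->
  (A %| B ^ 2 + N)%N -> (N %| 3 * A * k ^ 2 + 1)%N -> N = 1 %[mod 3] ->
  exists x y z : int, N%:Z = x ^+ 2 + 3 * y ^+ 2 + 3 * z ^+ 2.
Proof.
move=> A0 N0 /int_cofactor[C HC] /int_cofactor[j Hj] N1.
have HC' : A%:Z * C = B%:Z ^+ 2 + 1 * N%:Z by rewrite HC; lia.
have Hj' : N%:Z * j = 3 * A%:Z * k%:Z ^+ 2 + 1 by rewrite Hj; lia.
have j0 : 0 < j by nia.
have [n En] := int_mod3_eq1 N1.
have [] := glue_form _ _ j0 _ HC' Hj'; rewrite ?ltz_nat// => a0 al0 det R.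
have [|x [y [z E]]] := ternary_det3 a0 al0 det _ R.
  move=> [x [y [z E]]].
  have := glue_identity x y z HC' Hj'; rewrite -E.
  set l := _ + N%:Z * z; set w := _ + B%:Z * y; move: l w => l w.
  by move: HC'; rewrite En; exact: not_six_3_3_1.
have [|u [v [Eu Ev]]] := @sum_sqr_mod3 x y (N%:Z - z ^+ 2); first by rewrite mulrBr E addrK.
exists z, u, v; apply: (mulfI (isT : 3 != 0 :> int)).
by rewrite E Eu Ev; ring.
Qed.

(** * The four representation theorems *)

Lemma sign_character_jacobi n : odd n -> sign_character n (jacobi^~ n).
Proof.
move=> nodd; split=> [|a b|a b||a|a].
- by case: n nodd.
- exact: jacobi_mod.
- exact: jacobiM.
- exact: jacobi1.
- exact: jacobi_eq0.
- exact: jacobi_sqr.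
Qed.

Lemma sign_character_mul M1 M2 chi1 chi2 :
  sign_character M1 chi1 -> sign_character M2 chi2 ->
  sign_character (M1 * M2) (fun a => chi1 a * chi2 a).
Proof.
move=> H1 H2; split=> [|a b E|a b||a|a].
- by rewrite muln_gt0 (rchar_gt0 H1) (rchar_gt0 H2).
- have E1 : a = b %[mod M1] by rewrite -(modn_dvdm a (dvdn_mulr M2 (dvdnn M1))) E modn_dvdm// dvdn_mulr.
  have E2 : a = b %[mod M2] by rewrite -(modn_dvdm a (dvdn_mull M1 (dvdnn M2))) E modn_dvdm// dvdn_mull.
  by rewrite (rchar_mod H1 E1) (rchar_mod H2 E2).
- by rewrite (rcharM H1) (rcharM H2) mulrACA.
- by rewrite (rchar1 H1) (rchar1 H2).
- by rewrite mulf_eq0 (rchar_eq0 H1) (rchar_eq0 H2) coprimeMr negb_and.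
- by rewrite coprimeMr => /andP[c1 c2]; rewrite mulrACA (rchar_sqr H1)// (rchar_sqr H2).
Qed.

(* The character (2/.) for [s = -1] and (-2/.) for [s = 1], read off modulo 8. *)
Definition octic_sign (s : int) (a : nat) : int :=
  [:: 0; 1; 0; s; 0; -1; 0; - s]`_(a %% 8).

Lemma sign_character_octic s : s * s = 1 -> sign_character 8 (octic_sign s).
Proof.
move=> ss; rewrite /octic_sign; split=> // [a b ->//|a b|a|a].
- rewrite -modnMm; have := ltn_pmod a (isT : 0 < 8)%N; have := ltn_pmod b (isT : 0 < 8)%N.
  case: (a %% 8)%N => [|[|[|[|[|[|[|[|?]]]]]]]] //; case: (b %% 8)%N => [|[|[|[|[|[|[|[|?]]]]]]]] //= _ _;
  by rewrite ?mul0r ?mulr0 ?mul1r ?mulr1 ?mulN1r ?mulrN1 ?mulNr ?mulrN ?opprK ?oppr0 ?ss.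
- have -> : coprime a 8 = coprime (a %% 8) 8 by rewrite coprime_modl.
  have s0 : s != 0 by apply: contra_eq_neq ss => ->; rewrite mul0r.
  have := ltn_pmod a (isT : 0 < 8)%N.
  by case: (a %% 8)%N => [|[|[|[|[|[|[|[|?]]]]]]]] //= _; rewrite ?oppr_eq0 (negPf s0).
have -> : coprime a 8 = coprime (a %% 8) 8 by rewrite coprime_modl.
have := ltn_pmod a (isT : 0 < 8)%N.
by case: (a %% 8)%N => [|[|[|[|[|[|[|[|?]]]]]]]] //= _ _; rewrite ?mulrNN.
Qed.

Lemma odd_mod8 p : odd p ->
  [\/ [/\ p %% 8 = 1, ~~ odd p./2 & ~~ odd (p./2 - p./2./2)],
      [/\ p %% 8 = 3, odd p./2 & odd (p./2 - p./2./2)],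
      [/\ p %% 8 = 5, ~~ odd p./2 & odd (p./2 - p./2./2)]
    | [/\ p %% 8 = 7, odd p./2 & ~~ odd (p./2 - p./2./2)]]%N.
Proof.
move=> podd.
have : (p %% 8 = 1 \/ p %% 8 = 3 \/ p %% 8 = 5 \/ p %% 8 = 7)%N by lia.
by case=> [|[|[|]]] E; [constructor 1|constructor 2|constructor 3|constructor 4]; split=> //; lia.
Qed.

Lemma octic_sign_jacobi p : odd p ->
  octic_sign (-1) p = jacobi 2 p /\ octic_sign 1 p = (-1) ^+ p./2 * jacobi 2 p.
Proof.
move=> podd; rewrite jacobi2// /octic_sign -(signr_odd _ p./2) -(signr_odd _ (_ - _)).
by case: (odd_mod8 podd) => -[-> h1 h2]; rewrite ?(negPf h1) ?(negPf h2) ?h1 ?h2.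
Qed.

Lemma jacobi_pred n : odd n -> jacobi n.-1 n = (-1) ^+ n./2.
Proof.
by move=> nodd; apply: jacobiN1 => //; rewrite prednK//; case: n nodd.
Qed.

Lemma neg_square_mod_prime p n : prime p -> odd p -> jacobi n p = (-1) ^+ p./2 ->
  exists b, (p %| b ^ 2 + n)%N.
Proof.
move=> pr podd J; have p0 := prime_gt0 pr.
have [|b E] := @jacobi_square p (p.-1 * n)%N pr podd.
  rewrite jacobiM// J jacobi_pred// -exprD.
  by rewrite addnn -signr_odd odd_double.
exists b; rewrite /dvdn -modnDml E modnDml -{2}(mul1n n) -mulnDl addn1 prednK//.
by rewrite modnMr.
Qed.

(** For [n] congruent to 3 modulo 4, reciprocity equates the symbol of [-n] modulo [p] with that of
    [p] modulo [n]. *)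
Lemma jacobi_neg_square n p : odd n -> odd n./2 -> prime p -> odd p ->
  jacobi p n = 1 -> exists b, (p %| b ^ 2 + n)%N.
Proof.
move=> nodd hodd pr podd J; apply: neg_square_mod_prime => //.
have cop : coprime p n by apply/negPn; rewrite -jacobi_eq0// J.
have := jacobi_reciprocity nodd podd cop.
by rewrite J mul1r => ->; rewrite exprM -[in LHS](signr_odd _ n./2) hodd expr1.
Qed.

Lemma even_prime_neg_square n : exists b, (2 %| b ^ 2 + n)%N.
Proof. by exists (odd n); case: (boolP (odd n)) => h; rewrite dvdn2 oddD /= ?h ?(negPf h). Qed.

Lemma sqr_free_part_progression M chi K a : real_character M chi -> chi a = 1 ->
  (forall p, prime p -> chi p = 1 -> exists b, (p %| b ^ 2 + K)%N) ->
  exists A k B, [/\ (0 < A)%N, k ^ 2 * A = a %[mod M], (A %| B ^ 2 + K)%N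
    & forall p, prime p -> (p %| A)%N -> chi p = 1].
Proof.
move=> H chia sq; have [m [m0 E r]] := rchar_progression H chia.
have cop : coprime m M by apply/negPn; rewrite -(rchar_eq0 H) (rchar_mod H E) chia.
have [A [k [B [Em AB HA]]]] := divisor_sum_gt0_split H sq m0 cop r.
exists A, k, B; split=> //; last by rewrite -Em.
by move: m0; rewrite Em muln_gt0 => /andP[].
Qed.

Lemma three_squares_3mod8 m : exists x y z : int,
  (8 * m + 3)%N%:Z = x ^+ 2 + y ^+ 2 + z ^+ 2.
Proof.
set n := (8 * m + 3)%N.
have n0 : (0 < n)%N by rewrite /n addn3.
have nodd : odd n by rewrite oddD oddM.
have h : n./2 = (4 * m + 1)%N by rewrite /n; lia.
have hodd : odd n./2 by rewrite h oddD oddM.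
have h2 : (2 * n./2 = n.-1)%N by rewrite h /n; lia.
have JN1 : jacobi n.-1 n = -1.
  by rewrite jacobi_pred// -signr_odd hodd.
have J2 : jacobi 2 n = -1.
  rewrite jacobi2// h (_ : (_ - _)%N = (2 * m + 1)%N); last by lia.
  by rewrite -signr_odd oddD oddM.
have H : real_character n (jacobi^~ n).
  by split; [exact: sign_character_jacobi|exists n.-1].
(* The target class is [(n - 1) / 2]: both [-1] and [2] have symbol [-1]. *)
have Jh : jacobi n./2 n = 1.
  by have := jacobiM 2 n./2 nodd; rewrite h2 JN1 J2; lia.
have sq p : prime p -> jacobi p n = 1 -> exists b, (p %| b ^ 2 + n)%N.
  move=> pr J; have podd : odd p by case: (even_prime pr) => // p2; move: J; rewrite p2 J2.
  exact: jacobi_neg_square J.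
have [A [k [B [A0 EA AB HA]]]] := sqr_free_part_progression H Jh sq.
have Aodd : odd A.
  by apply/negPn/negP=> Ae; have := HA 2%N isT; rewrite dvdn2 Ae J2 => /(_ isT).
(* Gluing uses [2 * A], because [2 * A * k ^ 2] is congruent to [-1] modulo [n]; [A] is odd as [2]
   has symbol [-1]. *)
have [b Hb] := even_prime_neg_square n.
have [|B' AB'] := dvdn_sqrD_mul _ Hb AB; first by rewrite coprime2n.
apply: (glue_three_squares _ n0 AB' (k := k)); first by rewrite muln_gt0.
rewrite /dvdn -mulnA [(A * _)%N]mulnC -modnDml -modnMmr EA modnMmr modnDml h2.
by rewrite addn1 prednK// modnn.
Qed.

Lemma rep_3_3_1_7mod24 m : exists x y z : int,
  (24 * m + 7)%N%:Z = x ^+ 2 + 3 * y ^+ 2 + 3 * z ^+ 2.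
Proof.
set n := (24 * m + 7)%N.
have n0 : (0 < n)%N by rewrite /n !addnS.
have nodd : odd n by rewrite oddD oddM.
have h : n./2 = (12 * m + 3)%N by rewrite /n; lia.
have hodd : odd n./2 by rewrite h oddD oddM.
have JN1 : jacobi n.-1 n = -1.
  by rewrite jacobi_pred// -signr_odd hodd.
have n3 : n = 1 %[mod 3] by rewrite /n; lia.
have J3 : jacobi 3 n = -1.
  have cop : coprime 3 n by rewrite -coprime_modr n3.
  have := jacobi_reciprocity nodd (isT : odd 3) cop.
  by rewrite (jacobi_mod n3) jacobi1// mulr1 muln1 -signr_odd hodd.
(* The target class is [-1/3] modulo [n], so that [n] divides [3 * A * k ^ 2 + 1]. *)
have a3 : (3 * (8 * m + 2) = n.-1)%N by rewrite /n; lia.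
have H : real_character n (jacobi^~ n).
  by split; [exact: sign_character_jacobi|exists n.-1].
have Ja : jacobi (8 * m + 2) n = 1.
  by have := jacobiM 3 (8 * m + 2) nodd; rewrite a3 JN1 J3; lia.
have sq p : prime p -> jacobi p n = 1 -> exists b, (p %| b ^ 2 + n)%N.
  move=> pr J; case: (even_prime pr) => [->|podd]; first exact: even_prime_neg_square.
  exact: jacobi_neg_square J.
have [A [k [B [A0 EA AB HA]]]] := sqr_free_part_progression H Ja sq.
apply: (glue_3_3_1 A0 n0 AB (k := k)) => //.
rewrite /dvdn -mulnA [(A * _)%N]mulnC -modnDml -modnMmr EA modnMmr modnDml a3.
by rewrite addn1 prednK// modnn.
Qed.

Lemma rep_1_1_3_13mod24 m : exists x y z : int,
  (24 * m + 13)%N%:Z = x ^+ 2 + y ^+ 2 + 3 * z ^+ 2.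
Proof.
set n := (24 * m + 13)%N.
have n0 : (0 < n)%N by rewrite /n !addnS.
have nodd : odd n by rewrite oddD oddM.
have h : n./2 = (2 * (6 * m + 3))%N by rewrite /n; lia.
have n3 : n = 1 %[mod 3] by rewrite /n; lia.
have n1 : (1 <= 2 * n)%N by rewrite muln_gt0.
have n23 : 2 * n - 1 = 1 %[mod 3] by rewrite /n; lia.
(* The character attached to [-3 * n], as [n] is congruent to 1 modulo 4. The class [2 * n - 1] is
   [1] modulo 3 and [-1] modulo [n]. *)
pose chi a := jacobi a 3 * jacobi a n.
have W : sign_character (3 * n) chi.
  by apply: sign_character_mul; apply: sign_character_jacobi.
have J23 : jacobi 2 3 = -1 by rewrite jacobi2.
have H : real_character (3 * n) chi.
  split=> //; exists n.+1; rewrite /chi (@jacobi_mod 3 _ 2) ?J23; last by rewrite -addn1 -modnDml n3.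
  by rewrite (@jacobi_mod n _ 1) ?jacobi1 ?mulr1// -addn1 modnDl.
have chia : chi (2 * n - 1)%N = 1.
  rewrite /chi (jacobi_mod n23).
  rewrite (@jacobi_mod n _ n.-1); last by rewrite mul2n -addnn -addnBA// modnDl subn1.
  by rewrite jacobi1// jacobi_pred// h mul1r exprM sqrrN !expr1n.
have sq p : prime p -> chi p = 1 -> exists b, (p %| b ^ 2 + 3 * n)%N.
  move=> pr J; case: (even_prime pr) => [->|podd]; first exact: even_prime_neg_square.
  apply: neg_square_mod_prime => //.
  have : coprime p (3 * n) by apply/negPn; rewrite -(rchar_eq0 H) J.
  rewrite coprimeMr => /andP[c3 cn].
  have R3 := jacobi_reciprocity (isT : odd 3) podd c3.
  have Rn := jacobi_reciprocity nodd podd cn.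
  rewrite jacobiM// -[LHS]mul1r -{1}J /chi mulrACA R3 Rn h mul1n.
  by rewrite -mulnA exprM sqrrN !expr1n mulr1.
have [A [k [B [A0 EA AB HA]]]] := sqr_free_part_progression H chia sq.
apply: (glue_1_1_3 A0 n0 AB (k := k)) => //.
  have dn : (n %| 3 * n)%N by rewrite dvdn_mull.
  rewrite /dvdn [(A * _)%N]mulnC -modnDml -(modn_dvdm (k ^ 2 * A) dn) EA modn_dvdm// modnDml.
  by rewrite subnK// modnMl.
have E3 : k ^ 2 * A = 1 %[mod 3].
  rewrite -(modn_dvdm (k ^ 2 * A) (dvdn_mulr n (dvdnn 3))) EA modn_dvdm ?dvdn_mulr//.
have k3 : (k %% 3 = 1 \/ k %% 3 = 2 \/ k %% 3 = 0)%N by lia.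
have A3 : (A %% 3 = 1 \/ A %% 3 = 2 \/ A %% 3 = 0)%N by lia.
move: E3; rewrite -modnMm -modnXm.
by case: k3 => [->|[->|->]]; case: A3 => [->|[->|->]].
Qed.

Lemma rep_3_3_1_10mod12 m : exists x y z : int,
  (12 * m + 10)%N%:Z = x ^+ 2 + 3 * y ^+ 2 + 3 * z ^+ 2.
Proof.
set N := (12 * m + 10)%N; pose P := (6 * m + 5)%N.
have NP : N = (2 * P)%N by rewrite /N /P; lia.
have N0 : (0 < N)%N by rewrite /N !addnS.
have N3 : N = 1 %[mod 3] by rewrite /N; lia.
have P0 : (0 < P)%N by rewrite /P !addnS.
have Podd : odd P by rewrite oddD oddM.
have c8 : coprime 8 P by rewrite (coprime_pexpl 2 P (isT : 0 < 3)%N) coprime2n.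
(* Chosen so that [chi] is attached to [-2 * P]: reciprocity costs the sign of [-1] exactly when [P]
   is congruent to 3 modulo 4. *)
pose s : int := if odd P./2 then -1 else 1.
have ss : s * s = 1 by rewrite /s; case: ifP.
pose chi a := octic_sign s a * jacobi a P.
have W : sign_character (8 * P) chi.
  by apply: sign_character_mul; [exact: sign_character_octic|exact: sign_character_jacobi].
have chi_chinese c a : chi (chinese 8 P c a) = octic_sign s c * jacobi a P.
  rewrite /chi (rchar_mod (sign_character_octic ss) (chinese_modl c8 c a)).
  by rewrite (jacobi_mod (chinese_modr c8 c a)).
have H : real_character (8 * P) chi.
  by split=> //; exists (chinese 8 P 5 1); rewrite chi_chinese jacobi1.
have a3 : (3 * (4 * m + 3) + 1 = 2 * P)%N by rewrite /P; lia.
have copa : coprime (4 * m + 3) P.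
  rewrite /coprime -dvdn1; set g := gcdn _ _.
  have g1 : (g %| 3 * (4 * m + 3))%N by rewrite dvdn_mull// dvdn_gcdl.
  by rewrite -(dvdn_addr _ g1) a3 dvdn_mull// dvdn_gcdr.
(* Modulo [P] the class is [-1/3]; modulo 8 it is 1 or 5, where [octic_sign] is [1] or [-1], so
   [chi a = 1] can be arranged. *)
have [a [chia a8 aP]] : exists a, [/\ chi a = 1, odd a & a = 4 * m + 3 %[mod P]].
  have [c [c8' Hc]] : exists c, odd c /\ octic_sign s c * jacobi (4 * m + 3) P = 1.
    by case: (jacobi_pm1 Podd copa) => ->; [exists 1%N|exists 5%N].
  exists (chinese 8 P c (4 * m + 3)); rewrite chi_chinese Hc chinese_modr//; split=> //.
  by rewrite -(@odd_mod _ 8)// chinese_modl// odd_mod.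
have sq p : prime p -> chi p = 1 -> exists b, (p %| b ^ 2 + N)%N.
  move=> pr J; case: (even_prime pr) => [->|podd]; first exact: even_prime_neg_square.
  apply: neg_square_mod_prime => //.
  have cop : coprime p P.
    by have : coprime p (8 * P) by [apply/negPn; rewrite -(rchar_eq0 H) J]; rewrite coprimeMr => /andP[].
  have R := jacobi_reciprocity Podd podd cop.
  have yy := jacobi_sqr Podd cop.
  have [o1 o2] := octic_sign_jacobi podd.
  rewrite NP jacobiM//; move: J; rewrite /chi /s.
  move: R; rewrite exprM -(signr_odd _ P./2); case: odd; rewrite ?expr1 ?expr0 ?expr1n ?o1 ?o2.
    move=> R J; have -> : jacobi 2 p = jacobi p P by rewrite -[LHS]mulr1 -yy mulrA J mul1r.
    exact: R.
  move=> R J; have -> : jacobi P p = jacobi p P by rewrite -[LHS]mul1r -yy -mulrA R mulr1.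
  have ww : (-1) ^+ p./2 * (-1) ^+ p./2 = 1 :> int by rewrite -exprD addnn -signr_odd odd_double.
  by have := congr1 (fun t => (-1) ^+ p./2 * t) J; rewrite /= !mulrA ww mul1r mulr1.
have [A [k [B [A0 EA AB HA]]]] := sqr_free_part_progression H chia sq.
apply: (glue_3_3_1 A0 N0 AB (k := k)) => //.
rewrite -mulnA [(A * _)%N]mulnC NP Gauss_dvd ?coprime2n//; apply/andP; split.
  have : odd (k ^ 2 * A).
    by rewrite -(@odd_mod _ (8 * P)) ?EA ?odd_mod// oddM.
  by move=> ko; rewrite dvdn2 oddD [odd (3 * _)]oddM ko.
have dP : (P %| 8 * P)%N by rewrite dvdn_mull.
rewrite /dvdn -modnDml -modnMmr -(modn_dvdm (k ^ 2 * A) dP) EA modn_dvdm// aP modnMmr modnDml a3.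
by rewrite modnMl.
Qed.

(** * Congruence conditions on the variables *)

Lemma sqr_lift (m c X : int) : (m %| X - c)%Z || (m %| X + c)%Z ->
  exists x, X ^+ 2 = (m * x + c) ^+ 2.
Proof.
case/orP=> /dvdzP[q E]; [exists q|exists (- q)].
  by rewrite (_ : X = q * m + c); [ring|rewrite -E subrK].
by rewrite (_ : X = q * m - c); [ring|rewrite -E addrK].
Qed.

Lemma sqr_lift4 (X : int) : (X %% 2)%Z = 1 -> exists x, X ^+ 2 = (4 * x + 1) ^+ 2.
Proof. by move=> h; apply: sqr_lift; lia. Qed.

Lemma sqr_lift3 (X : int) : (X %% 3)%Z <> 0 -> exists x, X ^+ 2 = (3 * x + 1) ^+ 2.
Proof. by move=> h; apply: sqr_lift; lia. Qed.

Lemma sqr_lift6 (X : int) : (X %% 2)%Z = 1 -> (X %% 3)%Z <> 0 ->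
  exists x, X ^+ 2 = (6 * x + 1) ^+ 2.
Proof. by move=> h2 h3; apply: sqr_lift; lia. Qed.

(** A unit modulo 9 is determined up to sign by its square; oddness then fixes the class modulo
    18. *)
Lemma sqr_lift18 (X w c : int) : c \in [:: 1; 5; 7] -> (X %% 2)%Z = 1 ->
  X ^+ 2 = 9 * w + c ^+ 2 -> exists x, X ^+ 2 = (18 * x + c) ^+ 2.
Proof.
move=> hc h2 E; apply: sqr_lift.
have [q [r [Eq hr]]] : exists q r, X = 9 * q + r /\ 0 <= r < 9.
  by exists (X %/ 9)%Z, (X %% 9)%Z; lia.
have Er : ((r ^+ 2 - c ^+ 2) %% 9)%Z = 0.
  rewrite (_ : r ^+ 2 - c ^+ 2 = (w - 9 * q ^+ 2 - 2 * q * r) * 9) ?modzMl//.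
  by rewrite -[c ^+ 2](addKr (9 * w)) -E Eq; ring.
have {}hr : r = 0 \/ r = 1 \/ r = 2 \/ r = 3 \/ r = 4 \/ r = 5 \/ r = 6 \/ r = 7 \/ r = 8 by lia.
rewrite {E}Eq in h2 *; move: hc; rewrite !inE => /or3P[]/eqP Ec; rewrite {c}Ec in Er *;
by case: hr => [|[|[|[|[|[|[|[|]]]]]]]] Hr; rewrite {r}Hr in Er h2 *; lia.
Qed.

Lemma sqr_mod8 (X : int) :
  (exists q, X = 2 * q) \/ (exists q, X ^+ 2 = 8 * q + 1) /\ (X %% 2)%Z = 1.
Proof.
have [q [->|[->|->]]] : exists q : int, X = 2 * q \/ (X = 4 * q + 1 \/ X = 4 * q - 1).
- have E := divz_eq X 4; have : (X %% 4 = 0 \/ X %% 4 = 1 \/ X %% 4 = 2 \/ X %% 4 = 3)%Z by lia.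
  by case=> [|[|[|]]] H; rewrite H in E;
    [exists ((X %/ 4)%Z * 2)|exists (X %/ 4)%Z|exists ((X %/ 4)%Z * 2 + 1)|exists ((X %/ 4)%Z + 1)]; lia.
- by left; exists q.
- by right; split; [exists (2 * q ^+ 2 + q); ring|lia].
by right; split; [exists (2 * q ^+ 2 - q); ring|lia].
Qed.

(** Up to signs, multiplication of [X + Y * sqrt(-3)] by a sixth root of unity gives
    [(X + 3 * Y) / 2] and [(X - Y) / 2], or the same with [-Y]; one choice makes both odd. If 3
    divides [Y], both are prime to 3. *)
Lemma rotate_odd (X Y : int) : (X %% 2)%Z = 1 -> (Y %% 2)%Z = 1 -> (X %% 3)%Z <> 0 ->
  exists X' Y', [/\ (X' %% 2)%Z = 1, (Y' %% 2)%Z = 1, (X' %% 3)%Z <> 0, (Y' %% 3)%Z <> 0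
    & X' ^+ 2 + 3 * Y' ^+ 2 = X ^+ 2 + 3 * Y ^+ 2].
Proof.
move=> X2 Y2 X3.
have [Y0|Y3] : (Y %% 3)%Z = 0 \/ (Y %% 3)%Z <> 0 by lia.
  have [[t Et]|[t Et]] : (exists t, X = Y + 4 * t + 2) \/ (exists t, X = - Y + 4 * t + 2).
  - have : ((X - Y) %% 4 = 2 \/ (X + Y) %% 4 = 2)%Z by lia.
    by case=> H; [left; exists ((X - Y) %/ 4)%Z|right; exists ((X + Y) %/ 4)%Z]; lia.
  - exists (2 * Y + 2 * t + 1), (2 * t + 1); split; [lia..|].
    by rewrite Et; ring.
  - exists (- 2 * Y + 2 * t + 1), (2 * t + 1); split; [lia..|].
    by rewrite Et; ring.
by exists X, Y.
Qed.

Lemma odd_eisenstein_norm (a b : int) : ((a ^+ 2 + 3 * b ^+ 2) %% 2)%Z = 1 -> ((a + b) %% 2)%Z = 1.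
Proof.
have [[q ->]|[[q Eq] h]] := sqr_mod8 a; have [[t ->]|[[t Et] h']] := sqr_mod8 b.
- by rewrite !exprMn; lia.
- lia.
- lia.
by rewrite Eq Et; lia.
Qed.

Lemma rotate_mod5 (U V : int) : (U %% 5)%Z <> 0 ->
  ((3 * U - 4 * V) %% 5 <> 0 /\ (4 * U + 3 * V) %% 5 <> 0 \/
   (3 * U + 4 * V) %% 5 <> 0 /\ (4 * U - 3 * V) %% 5 <> 0)%Z.
Proof.
move=> U5; have [H|H] : ((V - 2 * U) %% 5 <> 0 \/ (V + 2 * U) %% 5 <> 0)%Z by lia.
  by left; split; lia.
by right; split; lia.
Qed.

Lemma split_mod5 (Y Z : int) : (Y %% 5)%Z <> 0 \/ (Z %% 5)%Z <> 0 ->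
  ((Y - 2 * Z) %% 5 <> 0 /\ (2 * Y + Z) %% 5 <> 0 \/
   (Y + 2 * Z) %% 5 <> 0 /\ (2 * Y - Z) %% 5 <> 0)%Z.
Proof.
move=> N5; have [H|H] : ((Y - 2 * Z) %% 5 <> 0 \/ (Y + 2 * Z) %% 5 <> 0)%Z by lia.
  by left; split; lia.
by right; split; lia.
Qed.

(** If 5 does not divide both, multiply [Y + Z * i] by [1 + 2i] or its conjugate. Otherwise solve
    for [Y / 5], [Z / 5] and multiply by [3 + 4i] or its conjugate, of norm 25; [Y] is odd, hence
    nonzero, so this descends. *)
Lemma five_sum_two_squares (Y Z : int) : (Y %% 2)%Z = 1 -> (Z %% 2)%Z = 1 ->
  exists U V, [/\ (U %% 2)%Z = 1, (V %% 2)%Z = 1, (U %% 5)%Z <> 0, (V %% 5)%Z <> 0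
    & U ^+ 2 + V ^+ 2 = 5 * (Y ^+ 2 + Z ^+ 2)].
Proof.
have [m] := ubnP (absz Y); elim: m => // m IH in Y Z *.
move=> Ym Y2 Z2.
have [[Y5 Z5]|N5] : (Y %% 5 = 0 /\ Z %% 5 = 0)%Z \/ ((Y %% 5)%Z <> 0 \/ (Z %% 5)%Z <> 0) by lia.
  have [y Ey] : exists y, Y = 5 * y by exists (Y %/ 5)%Z; lia.
  have [z Ez] : exists z, Z = 5 * z by exists (Z %/ 5)%Z; lia.
  have [||| U [V [U2 V2 U5 V5 E]]] := IH y z; [lia..|].
  have EE : 25 * (U ^+ 2 + V ^+ 2) = 5 * (Y ^+ 2 + Z ^+ 2) by rewrite E Ey Ez; ring.
  have [H|H] := rotate_mod5 V U5.
    exists (3 * U - 4 * V), (4 * U + 3 * V); case: H => ??; split=> //; [clear -U2 V2; lia..|].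
    by rewrite -EE; ring.
  exists (3 * U + 4 * V), (4 * U - 3 * V); case: H => ??; split=> //; [clear -U2 V2; lia..|].
  by rewrite -EE; ring.
have [H|H] := split_mod5 N5.
  by exists (Y - 2 * Z), (2 * Y + Z); case: H => ??; split=> //; [clear -Y2 Z2; lia..|ring].
by exists (Y + 2 * Z), (2 * Y - Z); case: H => ??; split=> //; [clear -Y2 Z2; lia..|ring].
Qed.

(** In a sum of three squares equal to [24 * j + 19], all variables are odd modulo 8, and modulo 3
    exactly two are multiples of 3. *)
Lemma rep_1_9_9_odd j : exists X Y Z : int,
  [/\ (X %% 2)%Z = 1, (Y %% 2)%Z = 1, (Z %% 2)%Z = 1
    & 24 * j%:Z + 19 = X ^+ 2 + 9 * (Y ^+ 2 + Z ^+ 2)].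
Proof.
have [x [y [z E]]] := three_squares_3mod8 (3 * j + 2).
have {}E : 24 * j%:Z + 19 = x ^+ 2 + y ^+ 2 + z ^+ 2 by rewrite -E; lia.
have [x2 y2 z2] : [/\ (x %% 2)%Z = 1, (y %% 2)%Z = 1 & (z %% 2)%Z = 1].
  by have [[a Ea]|[[a Ea] ha]] := sqr_mod8 x; have [[b Eb]|[[b Eb] hb]] := sqr_mod8 y;
     have [[c Ec]|[[c Ec] hc]] := sqr_mod8 z => //; exfalso; move: E;
     rewrite ?Ea ?Eb ?Ec ?exprMn; lia.
have fin X Y Z b c : (X %% 2)%Z = 1 -> (Y %% 2)%Z = 1 -> (Z %% 2)%Z = 1 ->
    Y = 3 * b -> Z = 3 * c -> 24 * j%:Z + 19 = X ^+ 2 + Y ^+ 2 + Z ^+ 2 ->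
    exists X Y Z : int, [/\ (X %% 2)%Z = 1, (Y %% 2)%Z = 1, (Z %% 2)%Z = 1
    & 24 * j%:Z + 19 = X ^+ 2 + 9 * (Y ^+ 2 + Z ^+ 2)].
  move=> X2 Y2 Z2 EY EZ ->; exists X, b, c; split=> //; [clear -Y2 EY; lia|clear -Z2 EZ; lia|].
  by rewrite EY EZ; ring.
have [a [Ea|Ea]] := sqr_mod3 x; have [b [Eb|Eb]] := sqr_mod3 y;
have [c [Ec|Ec]] := sqr_mod3 z;
try by (exfalso; move: E; rewrite ?Ea ?Eb ?Ec ?exprMn; lia).
- by apply: (fin z x y) Ea Eb _ => //; rewrite E; ring.
- by apply: (fin y x z) Ea Ec _ => //; rewrite E; ring.
- by apply: (fin x y z) Eb Ec _.
Qed.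

(** Multiplication of [a + b * sqrt(-3)] by [1 + sqrt(-3)], of norm 4. *)
Lemma rotate_even (a b : int) : ((a ^+ 2 + 3 * b ^+ 2) %% 2)%Z = 1 ->
  exists X Y, [/\ (X %% 2)%Z = 1, (Y %% 2)%Z = 1 & X ^+ 2 + 3 * Y ^+ 2 = 4 * (a ^+ 2 + 3 * b ^+ 2)].
Proof.
move=> /odd_eisenstein_norm h; exists (a - 3 * b), (a + b).
by split; [lia|lia|ring].
Qed.

Lemma rep_1_3_3_odd m : exists X Y Z : int,
  [/\ (X %% 2)%Z = 1, (Y %% 2)%Z = 1 /\ (Y %% 3)%Z <> 0, (Z %% 2)%Z = 1 /\ (Z %% 3)%Z <> 0
    & 24 * m%:Z + 7 = X ^+ 2 + 3 * Y ^+ 2 + 3 * Z ^+ 2].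
Proof.
have [x [y [z E]]] := rep_3_3_1_7mod24 m.
have {}E : 24 * m%:Z + 7 = x ^+ 2 + 3 * y ^+ 2 + 3 * z ^+ 2 by rewrite -E; lia.
have [X [Y [Z [X2 Y2 Z2 {}E]]]] : exists X Y Z : int, [/\ (X %% 2)%Z = 1, (Y %% 2)%Z = 1, (Z %% 2)%Z = 1
    & 24 * m%:Z + 7 = X ^+ 2 + 3 * Y ^+ 2 + 3 * Z ^+ 2].
  have [[a Ea]|[[a Ea] x2]] := sqr_mod8 x; have [[b Eb]|[[b Eb] y2]] := sqr_mod8 y;
  have [[c Ec]|[[c Ec] z2]] := sqr_mod8 z;
  try by (exfalso; move: E; rewrite ?Ea ?Eb ?Ec ?exprMn; lia).
  - have [|X [Y [X2 Y2 EXY]]] := @rotate_even a b.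
      by move: E; rewrite Ea Eb Ec !exprMn; clear; lia.
    exists X, Y, z; split=> //; rewrite E Ea Eb EXY; ring.
  - have [|X [Z [X2 Z2 EXZ]]] := @rotate_even a c.
      by move: E; rewrite Ea Eb Ec !exprMn; clear; lia.
    exists X, y, Z; split=> //; rewrite [RHS](_ : _ = X ^+ 2 + 3 * Z ^+ 2 + 3 * y ^+ 2); last by ring.
    by rewrite EXZ E Ea Ec; ring.
  - by exists x, y, z.
have X3 : (X %% 3)%Z <> 0.
  move=> h; have [q Eq] : exists q, X = 3 * q by exists (X %/ 3)%Z; lia.
  by move: E; rewrite Eq exprMn; clear; lia.
(* The first rotation makes [Y] prime to 3 and keeps [X] so, which allows a second one with [Z]. *)
have [X1 [Y1 [X12 Y12 X13 Y13 E1]]] := rotate_odd X2 Y2 X3.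
have [X4 [Z4 [X42 Z42 X43 Z43 E4]]] := rotate_odd X12 Z2 X13.
exists X4, Y1, Z4; split=> //.
rewrite [RHS](_ : _ = X4 ^+ 2 + 3 * Z4 ^+ 2 + 3 * Y1 ^+ 2); last by ring.
by rewrite E4 E -E1; ring.
Qed.

Lemma rep_1_9_3_odd m : exists X Y Z : int,
  [/\ (X %% 2)%Z = 1, (Y %% 2)%Z = 1 /\ (Y %% 3)%Z <> 0, (Z %% 2)%Z = 1 /\ (Z %% 3)%Z <> 0
    & 24 * m%:Z + 13 = X ^+ 2 + 9 * Y ^+ 2 + 3 * Z ^+ 2].
Proof.
have [x [y [z E]]] := rep_1_1_3_13mod24 m.
have {}E : 24 * m%:Z + 13 = x ^+ 2 + y ^+ 2 + 3 * z ^+ 2 by rewrite -E; lia.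
have {x y z E}[x [y [z E]]] : exists x y z : int, 24 * m%:Z + 13 = x ^+ 2 + 9 * y ^+ 2 + 3 * z ^+ 2.
  have [a [Ea|Ea]] := sqr_mod3 x; have [b [Eb|Eb]] := sqr_mod3 y;
  try by (exfalso; move: E; rewrite ?Ea ?Eb ?exprMn; lia).
  - by exists y, a, z; rewrite E Ea; ring.
  - by exists x, b, z; rewrite E Eb; ring.
have [X [Y [Z [X2 Y2 Z2 {}E]]]] : exists X Y Z : int, [/\ (X %% 2)%Z = 1, (Y %% 2)%Z = 1, (Z %% 2)%Z = 1
    & 24 * m%:Z + 13 = X ^+ 2 + 9 * Y ^+ 2 + 3 * Z ^+ 2].
  have [[a Ea]|[[a Ea] x2]] := sqr_mod8 x; have [[b Eb]|[[b Eb] y2]] := sqr_mod8 y;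
  have [[c Ec]|[[c Ec] z2]] := sqr_mod8 z;
  try by (exfalso; move: E; rewrite ?Ea ?Eb ?Ec ?exprMn; lia).
  - have [|X [Z [X2 Z2 EXZ]]] := @rotate_even a c.
      by move: E; rewrite Ea Eb Ec !exprMn; clear; lia.
    exists X, y, Z; split=> //; rewrite [RHS](_ : _ = X ^+ 2 + 3 * Z ^+ 2 + 9 * y ^+ 2); last by ring.
    by rewrite EXZ E Ea Ec; ring.
  - have [|Z [Y [Z2 Y2 EZY]]] := @rotate_even c b.
      by move: E; rewrite Ea Eb Ec !exprMn; clear; lia.
    exists x, Y, Z; split=> //.
    rewrite [RHS](_ : _ = x ^+ 2 + 3 * (Z ^+ 2 + 3 * Y ^+ 2)); last by ring.
    by rewrite EZY E Eb Ec; ring.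
  - by exists x, y, z.
have X3 : (X %% 3)%Z <> 0.
  move=> h; have [q Eq] : exists q, X = 3 * q by exists (X %/ 3)%Z; lia.
  by move: E; rewrite Eq exprMn; clear; lia.
(* The form contains both [X ^ 2 + 3 * Z ^ 2] and [3 * (Z ^ 2 + 3 * Y ^ 2)]; the first rotation
   makes [Z] prime to 3, as the second needs. *)
have [X1 [Z1 [X12 Z12 X13 Z13 E1]]] := rotate_odd X2 Z2 X3.
have [Z4 [Y4 [Z42 Y42 Z43 Y43 E4]]] := rotate_odd Z12 Y2 Z13.
exists X1, Y4, Z4; split=> //.
rewrite [RHS](_ : _ = X1 ^+ 2 + 3 * (Z4 ^+ 2 + 3 * Y4 ^+ 2)); last by ring.
rewrite E4 [RHS](_ : _ = X1 ^+ 2 + 3 * Z1 ^+ 2 + 9 * Y ^+ 2); last by ring.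
by rewrite E1 E; ring.
Qed.

Lemma rep_3_3_20_odd m : exists X Y Z : int,
  [/\ (X %% 2)%Z = 1, (Y %% 2)%Z = 1, (Z %% 3)%Z <> 0
    & 12 * m%:Z + 10 = 3 * (X ^+ 2 + Y ^+ 2) + 4 * Z ^+ 2].
Proof.
have [x [y [z E]]] := rep_3_3_1_10mod12 m.
have {}E : 12 * m%:Z + 10 = x ^+ 2 + 3 * y ^+ 2 + 3 * z ^+ 2 by rewrite -E; lia.
have [[a Ea]|[[a Ea] x2]] := sqr_mod8 x; have [[b Eb]|[[b Eb] y2]] := sqr_mod8 y;
have [[c Ec]|[[c Ec] z2]] := sqr_mod8 z;
try by (exfalso; move: E; rewrite ?Ea ?Eb ?Ec ?exprMn; lia).
exists y, z, a; split=> //; last by rewrite E Ea; ring.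
move=> h; have [q Eq] : exists q, a = 3 * q by exists (a %/ 3)%Z; lia.
by move: E; rewrite Ea Eq !exprMn; clear; lia.
Qed.

(** * Completing the squares *)

(** The factor [K] lets all three squares be completed over the integers. *)
Lemma universal_intro (K a1 a2 b1 b2 c1 c2 : int) : K != 0 ->
  admissible a1 a2 b1 b2 c1 c2 ->
  (forall n : nat, exists x y z : int,
    K * (2 * n%:Z) = K * (x * (a1 * x + a2) + y * (b1 * y + b2) + z * (c1 * z + c2))) ->
  universal a1 a2 b1 b2 c1 c2.
Proof.
move=> K0 adm H; split=> // n; have [x [y [z /(mulfI K0) E]]] := H n.
exists x, y, z; rewrite /half_value -!mulrDl -!intrD -E intrM.
by rewrite mulrAC mulfV ?mul1r.
Qed.

Lemma rep_1_9_9_residue5 n : exists x Y Z : int, [/\ (Y %% 2)%Z = 1, (Z %% 2)%Z = 1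
  & 72 * n%:Z + 43 = (18 * x + 5) ^+ 2 + 9 * (Y ^+ 2 + Z ^+ 2)].
Proof.
have [X [Y [Z [X2 Y2 Z2 E]]]] := rep_1_9_9_odd (3 * n + 1).
have [|x Ex] := @sqr_lift18 X (8 * n%:Z + 2 - Y ^+ 2 - Z ^+ 2) 5 isT X2.
  by rewrite -[LHS](addrK (9 * (Y ^+ 2 + Z ^+ 2))) -E PoszD PoszM; ring.
by exists x, Y, Z; split=> //; rewrite -Ex -E PoszD PoszM; ring.
Qed.

Lemma rep_1_9_9_residue7 n : exists x Y Z : int, [/\ (Y %% 2)%Z = 1, (Z %% 2)%Z = 1
  & 72 * n%:Z + 67 = (18 * x + 7) ^+ 2 + 9 * (Y ^+ 2 + Z ^+ 2)].
Proof.
have [X [Y [Z [X2 Y2 Z2 E]]]] := rep_1_9_9_odd (3 * n + 2).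
have [|x Ex] := @sqr_lift18 X (8 * n%:Z + 2 - Y ^+ 2 - Z ^+ 2) 7 isT X2.
  by rewrite -[LHS](addrK (9 * (Y ^+ 2 + Z ^+ 2))) -E PoszD PoszM; ring.
by exists x, Y, Z; split=> //; rewrite -Ex -E PoszD PoszM; ring.
Qed.

Lemma odd_squares_triangular (Y Z : int) : (Y %% 2)%Z = 1 -> (Z %% 2)%Z = 1 ->
  exists y z, Y ^+ 2 + Z ^+ 2 = (4 * y + 1) ^+ 2 + (4 * z + 1) ^+ 2.
Proof.
by move=> /sqr_lift4[y ->] /sqr_lift4[z ->]; exists y, z.
Qed.

(** [Y ^ 2 + Z ^ 2] is twice the sum of the squares of [(Y + Z) / 2] and [(Y - Z) / 2], exactly one
    of which is odd. *)
Lemma odd_squares_mixed (Y Z : int) : (Y %% 2)%Z = 1 -> (Z %% 2)%Z = 1 ->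
  exists y z, Y ^+ 2 + Z ^+ 2 = 2 * (4 * y + 1) ^+ 2 + 8 * z ^+ 2.
Proof.
move=> Y2 Z2.
have [u Eu] : exists u, Y = 2 * u - Z by exists ((Y + Z) %/ 2)%Z; lia.
have [h|h] : (u %% 2 = 1)%Z \/ ((u - Z) %% 2 = 1)%Z by lia.
  have [y Ey] := sqr_lift4 h; have [z Ez] : exists z, Z = u - 2 * z by exists ((u - Z) %/ 2)%Z; lia.
  by exists y, z; rewrite -Ey Eu Ez; ring.
have [y Ey] := sqr_lift4 h; have [z Ez] : exists z, u = 2 * z by exists (u %/ 2)%Z; lia.
by exists y, z; rewrite -Ey Eu Ez; ring.
Qed.

Lemma sqr_mod5_lift (U : int) : (U %% 2)%Z = 1 -> (U %% 5)%Z <> 0 ->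
  (exists y, U ^+ 2 = (10 * y + 3) ^+ 2) \/ (exists z, U ^+ 2 = (10 * z + 1) ^+ 2).
Proof.
move=> U2 U5.
have [h|h] : ((10 %| U - 3) || (10 %| U + 3))%Z \/ ((10 %| U - 1) || (10 %| U + 1))%Z by lia.
  by left; apply: sqr_lift.
by right; apply: sqr_lift.
Qed.

(** Two squares prime to 5 whose sum is a multiple of 5 are [1] and [-1] modulo 5, so one root is
    [1] and the other [3] up to sign. *)
Lemma odd_squares_quintuple (Y Z : int) : (Y %% 2)%Z = 1 -> (Z %% 2)%Z = 1 ->
  exists y z, 5 * (Y ^+ 2 + Z ^+ 2) = (10 * y + 3) ^+ 2 + (10 * z + 1) ^+ 2.
Proof.
move=> Y2 Z2; have [U [V [U2 V2 U5 V5 E]]] := five_sum_two_squares Y2 Z2.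
have [[y Ey]|[y Ey]] := sqr_mod5_lift U2 U5; have [[z Ez]|[z Ez]] := sqr_mod5_lift V2 V5.
- by exfalso; move: E; rewrite Ey Ez; clear; lia.
- by exists y, z; rewrite -E Ey Ez.
- by exists z, y; rewrite -E Ey Ez addrC.
by exfalso; move: E; rewrite Ey Ez; clear; lia.
Qed.

Lemma rep_1_9_3_residues (c : int) m n : c \in [:: 1; 5; 7] -> 72 * n%:Z + c ^+ 2 + 12 = 24 * m%:Z + 13 ->
  exists x y z : int,
    72 * n%:Z + c ^+ 2 + 12 = (18 * x + c) ^+ 2 + 9 * (6 * y + 1) ^+ 2 + 3 * (6 * z + 1) ^+ 2.
Proof.
move=> hc Em; have [X [Y [Z [X2 [Y2 Y3] [Z2 Z3] E]]]] := rep_1_9_3_odd m.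
have [z Ez] := sqr_lift6 Z2 Z3; have [y Ey] := sqr_lift6 Y2 Y3.
have [|x Ex] := @sqr_lift18 X (8 * n%:Z + 1 - Y ^+ 2 - 12 * z ^+ 2 - 4 * z) c hc X2.
  rewrite -[LHS](addrK (9 * Y ^+ 2)) -[X in X - _](addrK (3 * Z ^+ 2)) -E -Em Ez; ring.
by exists x, y, z; rewrite -Ex -Ey -Ez Em.
Qed.

Lemma rep_1_3_3_residues (c : int) m n : c \in [:: 1; 5; 7] -> 72 * n%:Z + c ^+ 2 + 6 = 24 * m%:Z + 7 ->
  exists x y z : int,
    72 * n%:Z + c ^+ 2 + 6 = (18 * x + c) ^+ 2 + 3 * (6 * y + 1) ^+ 2 + 3 * (6 * z + 1) ^+ 2.
Proof.
move=> hc Em; have [X [Y [Z [X2 [Y2 Y3] [Z2 Z3] E]]]] := rep_1_3_3_odd m.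
have [z Ez] := sqr_lift6 Z2 Z3; have [y Ey] := sqr_lift6 Y2 Y3.
have [|x Ex] := @sqr_lift18 X (8 * n%:Z - 12 * y ^+ 2 - 4 * y - 12 * z ^+ 2 - 4 * z) c hc X2.
  rewrite -[LHS](addrK (3 * Y ^+ 2)) -[X in X - _](addrK (3 * Z ^+ 2)) -E -Em Ey Ez; ring.
by exists x, y, z; rewrite -Ex -Ey -Ez Em.
Qed.

(** * Universality of the listed tuples *)

Theorem theorem2p2 :
  universal 9 1 4 2 3 1 /\
  universal 9 3 9 1 3 1 /\
  universal 9 5 4 2 4 2 /\
  universal 9 5 5 3 5 1 /\
  universal 9 5 8 4 2 0 /\
  universal 9 5 9 3 3 1 /\
  universal 9 7 4 2 4 2 /\
  universal 9 7 5 3 5 1 /\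
  universal 9 7 8 4 2 0 /\
  (forall c : int, c \in [:: 1; 5; 7] -> universal 9 c 3 1 3 1) /\
  universal 10 6 10 2 6 4.
Proof.
split; [|split; [|split; [|split; [|split; [|split; [|split; [|split; [|split; [|split]]]]]]]]].
(* [36 * x * (9 * x + 1) = (18 * x + 1) ^ 2 - 1], and similarly for the others. The number added in
   each case is the sum of the constants completing the squares, here [13 = 1 + 9 + 3]. *)
- apply: (@universal_intro 36) => // n.
  have [|X [Y [Z E]]] := @rep_1_9_3_residues 1 (3 * n) n isT; first by rewrite PoszM; ring.
  have [y Ey] := @sqr_lift4 (6 * Y + 1) ltac:(lia).
  exists X, y, Z; apply: (addIr 13); transitivity (72 * n%:Z + 1 ^+ 2 + 12); first by ring.
  by rewrite E Ey; ring.
- apply: (@universal_intro 36) => // n.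
  have [|X [Y [Z E]]] := @rep_1_9_3_residues 1 (3 * n) n isT; first by rewrite PoszM; ring.
  (* The pair [9, 3] completes to [9 * (6 * x + 1) ^ 2], so the first two variables trade places. *)
  exists Y, X, Z; apply: (addIr 13); transitivity (72 * n%:Z + 1 ^+ 2 + 12); first by ring.
  by rewrite E; ring.
- apply: (@universal_intro 36) => // n; have [x [Y [Z [Y2 Z2 E]]]] := rep_1_9_9_residue5 n.
  have [y [z Eyz]] := odd_squares_triangular Y2 Z2; exists x, y, z.
  apply: (addIr 43); transitivity (72 * n%:Z + 43); first by ring.
  by rewrite E Eyz; ring.
- apply: (@universal_intro 180) => // n; have [x [Y [Z [Y2 Z2 E]]]] := rep_1_9_9_residue5 n.
  have [y [z Eyz]] := odd_squares_quintuple Y2 Z2; exists x, y, z.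
  (* The extra factor 5 in [180] supplies [5 * (Y ^ 2 + Z ^ 2)]; [215 = 5 * 25 + 9 * 9 + 9]. *)
  apply: (addIr 215); transitivity (5 * (72 * n%:Z + 43)); first by ring.
  rewrite E [LHS](_ : _ = 5 * (18 * x + 5) ^+ 2 + 9 * (5 * (Y ^+ 2 + Z ^+ 2))); last by ring.
  by rewrite Eyz; ring.
- apply: (@universal_intro 36) => // n; have [x [Y [Z [Y2 Z2 E]]]] := rep_1_9_9_residue5 n.
  have [y [z Eyz]] := odd_squares_mixed Y2 Z2; exists x, y, z.
  apply: (addIr 43); transitivity (72 * n%:Z + 43); first by ring.
  by rewrite E Eyz; ring.
- apply: (@universal_intro 36) => // n.
  have [|X [Y [Z E]]] := @rep_1_9_3_residues 5 (3 * n + 1) n isT; first by rewrite PoszD PoszM; ring.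
  exists X, Y, Z; apply: (addIr 37); transitivity (72 * n%:Z + 5 ^+ 2 + 12); first by ring.
  by rewrite E; ring.
- apply: (@universal_intro 36) => // n; have [x [Y [Z [Y2 Z2 E]]]] := rep_1_9_9_residue7 n.
  have [y [z Eyz]] := odd_squares_triangular Y2 Z2; exists x, y, z.
  apply: (addIr 67); transitivity (72 * n%:Z + 67); first by ring.
  by rewrite E Eyz; ring.
- apply: (@universal_intro 180) => // n; have [x [Y [Z [Y2 Z2 E]]]] := rep_1_9_9_residue7 n.
  have [y [z Eyz]] := odd_squares_quintuple Y2 Z2; exists x, y, z.
  apply: (addIr 335); transitivity (5 * (72 * n%:Z + 67)); first by ring.
  rewrite E [LHS](_ : _ = 5 * (18 * x + 7) ^+ 2 + 9 * (5 * (Y ^+ 2 + Z ^+ 2))); last by ring.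
  by rewrite Eyz; ring.
- apply: (@universal_intro 36) => // n; have [x [Y [Z [Y2 Z2 E]]]] := rep_1_9_9_residue7 n.
  have [y [z Eyz]] := odd_squares_mixed Y2 Z2; exists x, y, z.
  apply: (addIr 67); transitivity (72 * n%:Z + 67); first by ring.
  by rewrite E Eyz; ring.
- move=> c hc; apply: (@universal_intro 36) => // [|n].
    by move: hc; rewrite !inE => /or3P[]/eqP->.
  have [m Em] : exists m : nat, 72 * n%:Z + c ^+ 2 + 6 = 24 * m%:Z + 7.
    by move: hc; rewrite !inE => /or3P[]/eqP->;
      [exists (3 * n)%N|exists (3 * n + 1)%N|exists (3 * n + 2)%N]; lia.
  have [x [y [z E]]] := rep_1_3_3_residues hc Em; exists x, y, z.
  apply: (addIr (c ^+ 2 + 6)); transitivity (72 * n%:Z + c ^+ 2 + 6); first by ring.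
  by rewrite E; ring.
apply: (@universal_intro 30) => // n; have [X [Y [Z [X2 Y2 Z3 E]]]] := rep_3_3_20_odd n.
have [x [y Exy]] := odd_squares_quintuple X2 Y2; have [z Ez] := sqr_lift3 Z3.
(* The completed squares carry coefficients 3, 3 and 20, with constant [50 = 3 * 9 + 3 + 20]. *)
exists x, y, z; apply: (addIr 50); transitivity (5 * (12 * n%:Z + 10)); first by ring.
rewrite E [LHS](_ : _ = 3 * (5 * (X ^+ 2 + Y ^+ 2)) + 20 * Z ^+ 2); last by ring.
by rewrite Exy Ez; ring.
Qed.
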